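(* Let $\nu,\rho,\alpha>0$. For every $(\mathbf{u}_h,p_h)\in \mathbf{X}_h\times Q_h$ there is exactly one pair $G(\mathbf{u}_h,p_h)=(G_1(\mathbf{u}_h,p_h),G_2(\mathbf{u}_h,p_h))\in \mathbf{X}_h\times Q_h$ satisfying the defining equations of the operator $G$ given in the context (that is, $G:\mathcal{H}_h\to\mathcal{H}_h$ is well-defined), and it satisfies $$\|G(\mathbf{u}_h,p_h)\|_{\mathcal{H}_h}\le \|(\mathbf{u}_h,p_h)\|_{\mathcal{H}_h}+\sqrt{\frac{\rho}{\nu}}\,\|\mathbf{f}\|_{-1}.$$
   Context: Let $d\in\{2,3\}$ and let $\Omega\subset\mathbb{R}^d$ be a bounded domain with Lipschitz boundary. $(\cdot,\cdot)$ and $\|\cdot\|$ denote the $L^2(\Omega)$ inner product and norm (for scalar, vector or matrix fields). Put $\mathbf{X}=[H_0^1(\Omega)]^d$ and $Q=L^2_0(\Omega)=\{q\in L^2(\Omega):\int_\Omega q=0\}$. Let $\mathbf{f}\in \mathbf{X}'$ (the dual of $\mathbf{X}$), write $(\mathbf{f},\mathbf{v})$ for the duality pairing, and let $\|\mathbf{f}\|_{-1}=\sup_{0\neq\mathbf{v}\in\mathbf{X}}|(\mathbf{f},\mathbf{v})|/\|\nabla\mathbf{v}\|$. Let $\mathbf{X}_h\subset\mathbf{X}$ and $Q_h\subset Q$ be finite-dimensional (finite element) subspaces. Skew-symmetric trilinear form: $b^*(\mathbf{u},\mathbf{v},\mathbf{w})=\tfrac12((\mathbf{u}\cdot\nabla)\mathbf{v},\mathbf{w})-\tfrac12((\mathbf{u}\cdot\nabla)\mathbf{w},\mathbf{v})$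 for $\mathbf{u},\mathbf{v},\mathbf{w}\in\mathbf{X}$. Product space and norm: $\mathcal{H}_h=\mathbf{X}_h\times Q_h$, $\|(\mathbf{v}_h,q_h)\|_{\mathcal{H}_h}=(\|\nabla\mathbf{v}_h\|^2+\alpha\|q_h\|^2)^{1/2}$. Operator $G$: for $(\mathbf{u}_h,p_h)\in\mathcal{H}_h$, $G(\mathbf{u}_h,p_h)=(\mathbf{U}_h,P_h)\in\mathcal{H}_h$, with $\mathbf{U}_h=G_1(\mathbf{u}_h,p_h)$ and $P_h=G_2(\mathbf{u}_h,p_h)$, is required to satisfy, for all $(\mathbf{v}_h,q_h)\in\mathbf{X}_h\times Q_h$, $$\tfrac1\rho(\nabla(\mathbf{U}_h-\mathbf{u}_h),\nabla\mathbf{v}_h)+\nu(\nabla\mathbf{U}_h,\nabla\mathbf{v}_h)+b^*(\mathbf{u}_h,\mathbf{U}_h,\mathbf{v}_h)+\tfrac{\rho}{\alpha}(\nabla\cdot\mathbf{U}_h,\nabla\cdot\mathbf{v}_h)-(p_h,\nabla\cdot\mathbf{v}_h)=(\mathbf{f},\mathbf{v}_h),$$ $$\alpha(P_h-p_h,q_h)+\rho(\nabla\cdot\mathbf{U}_h,q_h)=0.$$ *)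

(* Defs.v *)
From HB Require Import structures.
From mathcomp Require Import all_boot all_order all_algebra.
From mathcomp Require Import all_classical all_reals all_analysis.

Set Implicit Arguments.
Unset Strict Implicit.
Unset Printing Implicit Defensive.

Import Order.TTheory GRing.Theory Num.Theory.
Import numFieldNormedType.Exports.

Local Open Scope classical_set_scope.
Local Open Scope ring_scope.

(* R^n is 'rV[R]_n, whose topology (sup norm) is provided by MathComp-Analysis.
   Its sigma-algebra is the one generated by the coordinates, i.e., the product
   of n copies of the Borel sigma-algebra of R.                               *)
Section rV_measurable.
Variables (R : realType) (n : nat).

Let coor (i : 'I_n) (x : 'rV[R]_n) : measurableTypeR R := x ord0 i.

Let rV_set0 : g_sigma_preimage coor set0.
Proof. exact: sigma_algebra0. Qed.

Let rV_setC A : g_sigma_preimage coor A -> g_sigma_preimage coor (~` A).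
Proof. exact: sigma_algebraC. Qed.

Let rV_bigcup (F : (set 'rV[R]_n)^nat) :
  (forall i, g_sigma_preimage coor (F i)) ->
  g_sigma_preimage coor (\bigcup_i (F i)).
Proof. exact: sigma_algebra_bigcup. Qed.

HB.instance Definition _ := @isMeasurable.Build default_measure_display
  'rV[R]_n (g_sigma_preimage coor) rV_set0 rV_setC rV_bigcup.

Lemma measurable_coord (i : 'I_n) :
  measurable_fun [set: 'rV[R]_n]
    (fun x : 'rV[R]_n => x ord0 i : measurableTypeR R).
Proof.
move=> _ Y mY; rewrite setTI; apply: sub_sigma_algebra.
rewrite -bigcup_seq/=; exists i => /=; first by rewrite mem_index_enum.
by exists Y => //; rewrite setTI.
Qed.

Lemma measurable_fun_coordP d (T : measurableType d) (f : T -> 'rV[R]_n) :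
  (forall i, measurable_fun [set: T]
     (fun t => f t ord0 i : measurableTypeR R)) ->
  measurable_fun [set: T] f.
Proof.
move=> mf; apply: measurability; first exact: erefl.
move=> _ [B + <-] /=; rewrite -bigcup_seq/= => -[i _ [A mA <-]].
by rewrite !setTI -[X in measurable X]setTI; exact: mf.
Qed.

End rV_measurable.

Section rV_cons.
Variables (R : realType) (n : nat).

Definition rV_cons (p : measurableTypeR R * 'rV[R]_n) : 'rV[R]_n.+1 :=
  row_mx (\row_(_ < 1) (p.1 : R)) p.2.

Lemma rV_consEl p (j : 'I_1) : rV_cons p ord0 (lshift n j) = p.1.
Proof. by etransitivity; [exact: row_mxEl|rewrite mxE]. Qed.

Lemma rV_consEr p (j : 'I_n) : rV_cons p ord0 (rshift 1 j) = p.2 ord0 j.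
Proof. exact: row_mxEr. Qed.

Lemma measurable_rV_cons : measurable_fun setT rV_cons.
Proof.
apply: measurable_fun_coordP => i.
have [j ->|j ->] := @split_ordP 1 n i.
- under eq_fun do rewrite rV_consEl; exact: measurable_fst.
- under eq_fun do rewrite rV_consEr.
  by apply: (measurableT_comp (measurable_coord j)); exact: measurable_snd.
Qed.

Variable m : {sigma_finite_measure set 'rV[R]_n -> \bar R}.

Let lm : {measure set (measurableTypeR R * 'rV[R]_n)%type -> \bar R} :=
  (@lebesgue_measure R \x m)%E.

Definition leb_cons : set 'rV[R]_n.+1 -> \bar R := pushforward lm rV_cons.

Let leb_cons0 : leb_cons set0 = 0%E.
Proof. by rewrite /leb_cons /pushforward preimage_set0 measure0. Qed.

Let leb_cons_ge0 A : (0 <= leb_cons A)%E.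
Proof. by rewrite /leb_cons /pushforward; exact: (measure_ge0 lm). Qed.

Let leb_cons_sigma_additive : semi_sigma_additive leb_cons.
Proof.
move=> F mF tF mUF; rewrite /leb_cons /pushforward preimage_bigcup.
apply: (measure_semi_sigma_additive (s := lm)).
- by move=> i; rewrite -[X in measurable X]setTI; exact: measurable_rV_cons.
- apply/trivIsetP => i j _ _ ij; rewrite -preimage_setI.
  by move/trivIsetP : tF => /(_ _ _ _ _ ij) ->//; rewrite preimage_set0.
- rewrite -preimage_bigcup -[X in measurable X]setTI.
  exact: measurable_rV_cons.
Qed.

HB.instance Definition _ := isMeasure.Build _ _ _ leb_cons
  leb_cons0 leb_cons_ge0 leb_cons_sigma_additive.

Let leb_cons_sigma_finite : sigma_finite setT leb_cons.
Proof.
have [F TF Foo] : sigma_finite setT lm.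
  have /sigma_finiteP[F [TF ndF Foo]] := sigma_finiteT (@lebesgue_measure R).
  have /sigma_finiteP[G [TG ndG Goo]] := sigma_finiteT m.
  exists (fun k => F k `*` G k).
    rewrite -setXTT TF TG predeqE => -[x y]; split.
      move=> [/= [i _ Fix] [j _ Gjy]]; exists (maxn i j) => //; split.
        by move: x Fix; exact/subsetPset/ndF/leq_maxl.
      by move: y Gjy; exact/subsetPset/ndG/leq_maxr.
    by move=> [k _ []/= ? ?]; split; exists k.
  move=> k; have [? ?] := Foo k; have [? ?] := Goo k.
  split; first exact: measurableX.
  by rewrite /lm/= product_measure1E// lte_mul_pinfty// ge0_fin_numE.
pose uncons (x : 'rV[R]_n.+1) : measurableTypeR R * 'rV[R]_n :=
  (x ord0 (lshift n (ord0 : 'I_1)), \row_j x ord0 (rshift 1 j)).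
have uK : cancel rV_cons uncons.
  case=> a x; rewrite /uncons rV_consEl; congr pair.
  by apply/rowP => j; rewrite mxE rV_consEr.
have mu : measurable_fun setT uncons.
  apply: measurable_fun_pair; first exact: (@measurable_coord R n.+1 (lshift n (ord0 : 'I_1))).
  apply: measurable_fun_coordP => i.
  by under eq_fun do rewrite mxE; exact: (@measurable_coord R n.+1 (rshift 1 i)).
exists (fun k => uncons @^-1` F k).
  by rewrite -preimage_bigcup -TF preimage_setT.
move=> k; have [mFk Fk] := Foo k; split.
  by rewrite -[X in measurable X]setTI; exact: mu.
rewrite /leb_cons /pushforward -comp_preimage.
by rewrite (_ : uncons \o rV_cons = id)//; apply/funext => p /=; rewrite uK.
Qed.

HB.instance Definition _ := Measure_isSigmaFinite.Build _ _ _ leb_cons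
  leb_cons_sigma_finite.

End rV_cons.

(* Lebesgue measure on R^n, as the n-fold product of Lebesgue measure on R;
   rV_cons identifies R x R^n with R^n.+1.                                    *)
Fixpoint lebesgue_rV (R : realType) (n : nat) :
    {sigma_finite_measure set 'rV[R]_n -> \bar R} :=
  match n with
  | 0 => \d_(0 : 'rV[R]_0)
  | n'.+1 => leb_cons (lebesgue_rV R n')
  end.

(* Near each boundary point and in the orthonormal coordinates y = x *m A,
   Omega is the part of space above the graph of a Lipschitz function gamma,
   y_k > gamma(y_1, .., y_{k-1}, y_{k+1}, .., y_d).                           *)
Definition lipschitz_boundary (R : realType) (d : nat) (Omega : set 'rV[R]_d) :=
  forall x0, closure Omega x0 -> ~ Omega x0 ->
  exists (A : 'M[R]_d) (k : 'I_d) (gamma : 'rV[R]_d.-1 -> R),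
  [/\ A *m A^T = 1%:M,
      [lipschitz gamma y | y in setT] &
      \forall x \near x0, Omega x <->
        gamma (col' k (x *m A)) < (x *m A) ord0 k].

Definition lipschitz_domain (R : realType) (d : nat) (Omega : set 'rV[R]_d) :=
  [/\ open Omega, Omega !=set0, connected Omega, bounded_set Omega &
      lipschitz_boundary Omega].

Notation scalar_field R d := ('rV[R]_d -> R).
Notation vector_field R d := ('I_d -> 'rV[R]_d -> R).

Section spaces.
Variables (R : realType) (d : nat) (Omega : set 'rV[R]_d).
Local Notation mu := (lebesgue_rV R d).
Implicit Types (f g phi q : scalar_field R d) (u v w : vector_field R d).

(* Elements of L2(Omega) are represented by functions on R^d whose values
   outside of Omega are irrelevant; two of them are equal in L2(Omega) when they are
   related by ae_eqs (ae_eqv, for vector fields).                             *)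
Definition L2 : set (scalar_field R d) :=
  [set f | (f \_ Omega) \in Lfun mu 2%:E].

Definition L20 : set (scalar_field R d) :=
  [set q | L2 q /\ \int[mu]_(x in Omega) q x = 0].

Definition L2dot f g : R := \int[mu]_(x in Omega) (f x * g x).
Definition L2norm f : R := Num.sqrt (L2dot f f).

Definition ae_eqs f g : Prop := ae_eq mu Omega f g.
Definition ae_eqv u v : Prop := forall i, ae_eqs (u i) (v i).

Definition classical_partial (i : 'I_d) phi : scalar_field R d :=
  'D_(delta_mx ord0 i) phi.

Fixpoint Ck (k : nat) phi : Prop :=
  match k with
  | 0 => continuous phi
  | k'.+1 => (forall x, differentiable phi x) /\
             forall i, Ck k' (classical_partial i phi)
  end.

Definition test_fun : set (scalar_field R d) :=
  [set phi | (forall k, Ck k phi) /\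
     exists K, [/\ compact K, K `<=` Omega & forall x, ~ K x -> phi x = 0]].

Definition is_weak_partial (i : 'I_d) f g : Prop :=
  forall phi, test_fun phi ->
    L2dot f (classical_partial i phi) = - L2dot g phi.

Definition H1space : set (scalar_field R d) :=
  [set f | L2 f /\ forall i, exists2 g, L2 g & is_weak_partial i f g].

(* A representative of the weak partial derivative, which is unique up to
   equality a.e. on Omega; the default value 0 is not meaningful.             *)
Definition partial (i : 'I_d) f : scalar_field R d :=
  xget 0 [set g | L2 g /\ is_weak_partial i f g].

Definition H1norm f : R :=
  Num.sqrt (L2norm f ^+ 2 + \sum_(i < d) L2norm (partial i f) ^+ 2).

Definition H10space : set (scalar_field R d) :=
  [set f | H1space f /\
     forall eps, 0 < eps -> exists2 phi, test_fun phi & H1norm (f - phi) < eps].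

Definition Xspace : set (vector_field R d) := [set v | forall i, H10space (v i)].

Definition divergence v : scalar_field R d :=
  fun x => \sum_(i < d) partial i (v i) x.

Definition grad_dot u v : R :=
  \sum_(i < d) \sum_(j < d) L2dot (partial j (u i)) (partial j (v i)).
Definition grad_norm v : R := Num.sqrt (grad_dot v v).

Definition convect u v : vector_field R d :=
  fun i x => \sum_(j < d) u j x * partial j (v i) x.

Definition vdot u v : R := \sum_(i < d) L2dot (u i) (v i).

Definition bstar u v w : R :=
  2^-1 * vdot (convect u v) w - 2^-1 * vdot (convect u w) v.

Definition Xnorm v : R := Num.sqrt (\sum_(i < d) H1norm (v i) ^+ 2).

(* Xnorm is the full H1 norm; boundedness with respect to the gradient norm,
   hence finiteness of dual_norm, follows by Poincare's inequality.           *)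
Definition in_dual (F : vector_field R d -> R) : Prop :=
  (forall a u v, Xspace u -> Xspace v -> F (a *: u + v) = a * F u + F v) /\
  exists C, forall v, Xspace v -> `|F v| <= C * Xnorm v.

Definition dual_norm (F : vector_field R d -> R) : R :=
  sup [set `|F v| / grad_norm v | v in [set v | Xspace v /\ ~ ae_eqv v 0]].

Definition Hnorm (alpha : R) (v : vector_field R d) q : R :=
  Num.sqrt (grad_norm v ^+ 2 + alpha * L2norm q ^+ 2).

Definition is_G (Xh : set (vector_field R d)) (Qh : set (scalar_field R d))
    (F : vector_field R d -> R) (nu rho alpha : R) (u : vector_field R d)
    (p : scalar_field R d) (U : vector_field R d) (P : scalar_field R d) :=
  [/\ Xh U, Qh P &
    forall v q, Xh v -> Qh q ->
      rho^-1 * grad_dot (U - u) v + nu * grad_dot U v + bstar u U v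
        + rho / alpha * L2dot (divergence U) (divergence v)
        - L2dot p (divergence v) = F v
      /\ alpha * L2dot (P - p) q + rho * L2dot (divergence U) q = 0].

End spaces.

(* A linear space of representatives, finite dimensional modulo the equality eqV
   of the classes they represent.                                             *)
Definition fin_dim_subspace (R : realType) (V : lmodType R)
    (eqV : V -> V -> Prop) (S : set V) : Prop :=
  [/\ S 0,
      forall (a : R) u v, S u -> S v -> S (a *: u + v) &
      exists (n : nat) (b : 'I_n -> V), (forall i, S (b i)) /\
        forall v, S v -> exists c : 'I_n -> R, eqV v (\sum_(i < n) c i *: b i)].

(* Main.v *)
(** Idea. On [Xh] the momentum equation reads [a(U, v) = l(v)] where, because
    [bstar] vanishes when its last two arguments agree, [a(v, v) >= nu |grad v|^2];
    by Poincare's inequality [a(v, v) = 0] forces [v = 0] a.e., so the finite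
    linear system is uniquely solvable, and the pressure is then an [L2] projection
    onto [Qh].  Testing with [(U, P)], polarizing [(grad (U - u), grad U)] and
    [(P - p, P)], and absorbing [(div U, P - p)] by the grad-div term gives
    [|grad U|^2 + alpha |P|^2 <= |grad u|^2 + alpha |p|^2 + rho / nu |f|_{-1}^2].

    The forms are bilinear only modulo null sets and only where their integrals
    converge.  The first point needs uniqueness of weak derivatives, obtained by
    testing against bump functions that converge to indicators of orthants; the
    second needs [H10] to embed in [L4] for [d <= 3], which is Ladyzhenskaya's
    inequality. *)

Require Import Defs.
From mathcomp Require Import all_boot all_order all_algebra.
From mathcomp Require Import all_classical all_reals all_analysis.
From mathcomp Require Import measurable_realfun ring lra.
Import Order.TTheory GRing.Theory Num.Theory.
Import numFieldNormedType.Exports.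
Local Open Scope classical_set_scope.
Local Open Scope ring_scope.

Set Implicit Arguments.
Unset Strict Implicit.
Unset Printing Implicit Defensive.

(** * Boxes and measurability in R^n *)

(** Every inequality on [H10space] is first proved for compactly supported smooth functions, where
    the only analytic input is the fundamental theorem of calculus on a line: |f(x)| is at most the
    integral of |d_i f| along the line through x in direction i. Slicing R^(n+1) as R x R^n with
    [rV_cons] and Tonelli's theorem turn this into the Poincare and Ladyzhenskaya bounds, and
    density carries them over to [H10space]. The obstacle there is that density gives closeness in
    the H1 norm and no pointwise convergence. Fourth powers are therefore bounded first for the
    truncations min(|f|, k), for which a small L2 error suffices, and k tends to infinity
    afterwards. *)

Section boxes.
Variables (R : realType) (n : nat).
Implicit Types (x : 'rV[R]_n) (O A : set 'rV[R]_n) (p : {ffun 'I_n -> rat * rat}).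

(** Rational corners make the family countable. The bump of a box is positive on [box] and vanishes
    off the compact set [cbox], hence the pair. *)
Definition box p : set 'rV[R]_n :=
  [set x | forall i, ratr (p i).1 < x ord0 i < ratr (p i).2].

Definition cbox p : set 'rV[R]_n :=
  [set x | forall i, ratr (p i).1 <= x ord0 i <= ratr (p i).2].

Lemma box_cbox p : box p `<=` cbox p.
Proof. by move=> x xp i; have /andP[/ltW -> /ltW ->] := xp i. Qed.

Lemma open_box_nbhs O x : open O -> O x -> exists2 p, box p x & cbox p `<=` O.
Proof.
move=> oO Ox; have /nbhs_ballP[e /= e0 eO] : nbhs x O by exact: open_nbhs_nbhs.
have ball_O (y : 'rV[R]_n) : (forall i, `|x ord0 i - y ord0 i| < e) -> O y.
  by move=> xy; apply: eO; split=> // i j; rewrite ord1; exact: xy.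
have /choice[q qP] i : exists q : rat * rat,
    x ord0 i - e < ratr q.1 < x ord0 i /\ x ord0 i < ratr q.2 < x ord0 i + e.
  have /rat_in_itvoo[a] : x ord0 i - e < x ord0 i by rewrite ltrBlDr ltrDl.
  have /rat_in_itvoo[b] : x ord0 i < x ord0 i + e by rewrite ltrDl.
  by rewrite !in_itv /= => b1 a1; exists (a, b).
exists (finfun q) => [i|y yp].
  by rewrite ffunE; have [/andP[_ ->] /andP[-> _]] := qP i.
apply: ball_O => i; have := yp i; rewrite ffunE.
have [/andP[? ?] /andP[? ?]] := qP i => /andP[? ?].
by rewrite ltr_norml; apply/andP; split; lra.
Qed.

Lemma measurable_bigcap_coord (B : 'I_n -> set R) :
  (forall i, measurable (B i : set (measurableTypeR R))) ->
  measurable [set x : 'rV[R]_n | forall i, B i (x ord0 i)].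
Proof.
move=> mB.
have -> : [set x : 'rV[R]_n | forall i, B i (x ord0 i)] =
    \big[setI/setT]_(i <- enum 'I_n) (fun x : 'rV[R]_n => x ord0 i) @^-1` B i.
  rewrite -bigcap_seq; apply/seteqP; split => x /=.
    by move=> xB i _; exact: xB.
  by move=> xB i; apply: xB; rewrite /= mem_enum.
elim/big_ind : _ => [|? ?|i _]; [exact: measurableT|exact: measurableI|].
by have := @measurable_coord R n i measurableT _ (mB i); rewrite setTI.
Qed.

Lemma measurable_box p : measurable (box p).
Proof.
have -> : box p = [set x | forall i, `]ratr (p i).1, ratr (p i).2[%classic (x ord0 i)].
  by apply/seteqP; split => x /= xp i; have := xp i; rewrite in_itv.
apply: (@measurable_bigcap_coord (fun i => `]ratr (p i).1, ratr (p i).2[%classic)) => i.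
exact: measurable_itv.
Qed.

(** The sigma-algebra comes from the coordinates and not from the topology; the two meet because an
    open set is a countable union of rational boxes. *)
Lemma open_rV_measurable O : open O -> measurable O.
Proof.
move=> oO.
have -> : O = \bigcup_(p in [set p | cbox p `<=` O]) box p.
  apply/seteqP; split => [x Ox|x [p pO]].
    by have [p xp pO] := open_box_nbhs oO Ox; exists p.
  by move/box_cbox/pO.
rewrite bigcup_mkcond; apply: countable_bigcupT_measurable; first exact: countableP.
by move=> p; case: ifPn => // _; exact: measurable_box.
Qed.

Lemma continuous_rV_measurable (f : 'rV[R]_n -> R) : continuous f ->
  measurable_fun [set: 'rV[R]_n] (f : 'rV[R]_n -> measurableTypeR R).
Proof.
move=> /continuousP cf; apply: (measurability _ (RGenOInfty.measurableE R)).
move=> _ [_ [a ->] <-]; rewrite setTI.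
by apply: open_rV_measurable; apply: cf; exact: interval_open.
Qed.

(** Localization: a null set is recognized box by box, and on a box whose closure lies in [O] a bump
    function is available. *)
Lemma negligible_open_cover O A (mu : {measure set 'rV[R]_n -> \bar R}) :
  open O -> (forall p, cbox p `<=` O -> mu.-negligible (box p `&` A)) ->
  mu.-negligible (O `&` A).
Proof.
move=> oO pA.
pose B (p : {ffun 'I_n -> rat * rat}) := if pselect (cbox p `<=` O) then box p `&` A else set0.
have BN p : mu.-negligible (B p).
  by rewrite /B; case: pselect => // pO; [exact: pA|exact: negligible_set0].
pose C k := if unpickle k is Some p then B p else set0.
have CN k : mu.-negligible (C k).
  by rewrite /C; case: unpickle => [p|]; [exact: BN|exact: negligible_set0].
apply: negligibleS (negligible_bigcup CN) => x [Ox Ax].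
have [p xp pO] := open_box_nbhs oO Ox.
by exists (pickle p) => //; rewrite /C pickleK /B; case: pselect.
Qed.

End boxes.

(** * The space L2 *)

Section L2_calculus.
Variables (R : realType) (d : nat) (Omega : set 'rV[R]_d).
Hypothesis mOmega : measurable Omega.
Local Notation mu := (lebesgue_rV R d).
Implicit Types (f g h : 'rV[R]_d -> R).

Lemma L2P f : L2 Omega f <->
  measurable_fun Omega f /\ mu.-integrable Omega (EFin \o (fun x => f x ^+ 2)).
Proof.
have E : (EFin \o (fun x => f x ^+ 2)) \_ Omega =
    EFin \o (fun x => (f \_ Omega) x ^+ 2).
  by apply/funext => x /=; rewrite /patch; case: ifP => //= _; rewrite expr0n.
split=> [l2f|[mf i2f]].
  split; last by rewrite integrable_mkcond// E; exact: Lfun2_integrable_sqr.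
  by apply/(measurable_restrictT _ mOmega); move: l2f => /sub_Lfun_mfun; rewrite inE.
rewrite /L2/=; apply/andP; rewrite !inE/=.
have mfO : measurable_fun setT (f \_ Omega) by apply/(measurable_restrictT _ mOmega).
split; first exact: mfO.
rewrite /finite_norm unlock; apply: poweR_lty.
move: i2f; rewrite integrable_mkcond// E => /integrableP[_]; apply: le_lt_trans.
apply: ge0_le_integral => //.
- by move=> x _; rewrite poweR_ge0.
- apply/measurable_EFinP/(@measurableT_comp _ _ _ _ _ _ (fun x : R => x `^ 2)) => //.
  exact: measurableT_comp.
- apply/measurable_EFinP/measurableT_comp => //.
  exact: measurable_funX.
- by move=> x _; rewrite /= lee_fin normrX powR_mulrn.
Qed.

Lemma L2_measurable f : L2 Omega f -> measurable_fun Omega f.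
Proof. by case/L2P. Qed.

Lemma L2_mul_integrable f g : L2 Omega f -> L2 Omega g ->
  mu.-integrable Omega (EFin \o (fun x => f x * g x)).
Proof.
move=> /L2P[mf f2] /L2P[mg g2].
apply: (@le_integrable _ _ _ mu Omega mOmega _
   ((EFin \o (fun x => f x ^+ 2)%R) \+ (EFin \o (fun x => g x ^+ 2)%R))%E).
- exact/measurable_EFinP/measurable_funM.
- move=> x _ /=; rewrite lee_fin normrM [leRHS]ger0_norm ?addr_ge0 ?sqr_ge0//.
  rewrite -(real_normK (num_real (f x))) -(real_normK (num_real (g x))).
  by have := sqr_ge0 (`|f x| - `|g x|); nra.
- exact: integrableD.
Qed.

Lemma L2_of_sqr_le f (F : 'rV[R]_d -> R) : measurable_fun Omega f ->
  mu.-integrable Omega (EFin \o F) -> (forall x, Omega x -> f x ^+ 2 <= F x) ->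
  L2 Omega f.
Proof.
move=> mf iF fF; apply/L2P; split => //.
apply: le_integrable iF => //.
- by apply/measurable_EFinP; exact: measurable_funX.
- move=> x Ox /=; rewrite lee_fin [leLHS]ger0_norm ?sqr_ge0//.
  exact: le_trans (fF _ Ox) (ler_norm _).
Qed.

Lemma L2_lin a f g : L2 Omega f -> L2 Omega g -> L2 Omega (a *: f + g).
Proof.
move=> /L2P[mf f2] /L2P[mg g2].
pose F x : R := 2 * (a ^+ 2 * f x ^+ 2) + 2 * g x ^+ 2.
apply: (@L2_of_sqr_le _ F).
- by apply: measurable_funD => //; exact: measurable_funM.
- have -> : EFin \o F = ((fun x => 2%:E * (a ^+ 2)%:E * (EFin \o (fun x => f x ^+ 2)%R) x) \+
     (fun x => 2%:E * (EFin \o (fun x => g x ^+ 2)%R) x))%E.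
    by apply/funext => x; rewrite /F /= EFinD !EFinM muleA.
  by apply: integrableD => //; rewrite -?EFinM; exact: integrableZl.
- move=> x _; rewrite /F (_ : (a *: f + g) x = a * f x + g x)//.
  by have := sqr_ge0 (a * f x - g x); nra.
Qed.

Lemma L2_0 : L2 Omega 0.
Proof.
apply/L2P; split; first exact: measurable_cst.
by rewrite (_ : _ \o _ = cst 0%E); [exact: integrable0|apply/funext => x /=; rewrite expr0n].
Qed.

Lemma L2_sum (I : eqType) (r : seq I) (F : I -> 'rV[R]_d -> R) :
  (forall i, i \in r -> L2 Omega (F i)) -> L2 Omega (\sum_(i <- r) F i).
Proof.
elim: r => [_|i r IH h]; first by rewrite big_nil; exact: L2_0.
rewrite big_cons -[F i]scale1r; apply: L2_lin; first by apply: h; rewrite mem_head.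
by apply: IH => j jr; apply: h; rewrite in_cons jr orbT.
Qed.

Lemma L2dotC f g : L2dot Omega f g = L2dot Omega g f.
Proof. by apply: eq_Rintegral => x _; rewrite mulrC. Qed.

Lemma L2_integral_sqr f : L2 Omega f ->
  (\int[mu]_(x in Omega) (f x ^+ 2)%:E = (L2dot Omega f f)%:E)%E.
Proof.
by move=> lf; rewrite fineK// integrable_fin_num//; exact: L2_mul_integrable.
Qed.

Lemma L2dot_linl a f g h : L2 Omega f -> L2 Omega g -> L2 Omega h ->
  L2dot Omega (a *: f + g) h = a * L2dot Omega f h + L2dot Omega g h.
Proof.
move=> lf lg lh; rewrite -RintegralZl//; last exact: L2_mul_integrable.
rewrite -RintegralD//; last exact: L2_mul_integrable.
- by apply: eq_Rintegral => x _; rewrite mulrA -mulrDl.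
- have := integrableZl mOmega a (L2_mul_integrable lf lh).
  by apply: eq_integrable => // x _ /=; rewrite EFinM.
Qed.

Lemma L2dot_linr a f g h : L2 Omega f -> L2 Omega g -> L2 Omega h ->
  L2dot Omega h (a *: f + g) = a * L2dot Omega h f + L2dot Omega h g.
Proof. by move=> *; rewrite !(L2dotC h) L2dot_linl. Qed.

Lemma L2dot_ge0 f : 0 <= L2dot Omega f f.
Proof. by apply: Rintegral_ge0 => x _; rewrite -expr2 sqr_ge0. Qed.

Lemma L2normK f : L2norm Omega f ^+ 2 = L2dot Omega f f.
Proof. by rewrite sqr_sqrtr// L2dot_ge0. Qed.

Lemma ae_eqs_refl f : ae_eqs Omega f f.
Proof. exact: ae_eq_refl. Qed.

Lemma ae_eqs_lin a f g f' g' : ae_eqs Omega f f' -> ae_eqs Omega g g' ->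
  ae_eqs Omega (a *: f + g) (a *: f' + g').
Proof.
rewrite /ae_eqs /ae_eq; apply: filterS2 => x ff gg Ox.
by rewrite (_ : (a *: f + g) x = a * f x + g x)// ff// gg.
Qed.

Lemma L2dot_ae f g h : L2 Omega f -> L2 Omega g -> L2 Omega h ->
  ae_eqs Omega f g -> L2dot Omega f h = L2dot Omega g h.
Proof.
move=> /L2_measurable mf /L2_measurable mg /L2_measurable mh fg.
congr fine; apply: ae_eq_integral => //.
- by apply/measurable_EFinP; exact: measurable_funM.
- by apply/measurable_EFinP; exact: measurable_funM.
- by move: fg; apply: filterS => x fg Ox; rewrite fg.
Qed.

Lemma L2dot_eq0 f : L2 Omega f -> L2dot Omega f f = 0 -> ae_eqs Omega f 0.
Proof.
move=> lf f0; have If := L2_mul_integrable lf lf.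
have : (\int[mu]_(x in Omega) `|(EFin \o (fun x => f x * f x)%R) x| = 0)%E.
  rewrite (_ : (\int[mu]_(x in Omega) _)%E = \int[mu]_(x in Omega) (f x * f x)%:E)%E.
    by rewrite -[LHS]fineK ?integrable_fin_num//; congr EFin.
  by apply: eq_integral => x _ /=; rewrite ger0_norm// -expr2 sqr_ge0.
move/(ae_eq_integral_abs mu mOmega (measurable_int _ If)).1.
rewrite /ae_eqs /ae_eq; apply: filterS => x + Ox => /(_ Ox) /=.
by case=> /eqP; rewrite mulf_eq0 orbb => /eqP.
Qed.

Lemma L2dot_sqr_lin a f g : L2 Omega f -> L2 Omega g ->
  L2dot Omega (a *: f + g) (a *: f + g) =
  a ^+ 2 * L2dot Omega f f + 2 * a * L2dot Omega f g + L2dot Omega g g.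
Proof.
move=> lf lg; rewrite L2dot_linl//; last exact: L2_lin.
by rewrite !L2dot_linr// (L2dotC g f); ring.
Qed.

Lemma L2_cauchy_schwarz f g : L2 Omega f -> L2 Omega g ->
  L2dot Omega f g ^+ 2 <= L2dot Omega f f * L2dot Omega g g.
Proof.
move=> lf lg.
have D a : 0 <= a ^+ 2 * L2dot Omega f f + 2 * a * L2dot Omega f g + L2dot Omega g g.
  by rewrite -L2dot_sqr_lin//; exact: L2dot_ge0.
have := L2dot_ge0 f; rewrite le_eqVlt => /predU1P[f0|f0].
  have [->|fg0] := eqVneq (L2dot Omega f g) 0; first by rewrite -f0 mul0r expr0n.
  (* When [f] has zero norm the quadratic is affine in [a]; at this [a] it would equal -1. *)
  have := D (- (L2dot Omega g g + 1) / (2 * L2dot Omega f g)).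
  by rewrite -f0 mulr0 add0r mulrAC mulrCA divff ?mulf_neq0// mulr1; lra.
(* The minimizer of the quadratic. *)
have := D (- L2dot Omega f g / L2dot Omega f f).
have -> : (- L2dot Omega f g / L2dot Omega f f) ^+ 2 * L2dot Omega f f +
    2 * (- L2dot Omega f g / L2dot Omega f f) * L2dot Omega f g + L2dot Omega g g =
    L2dot Omega g g - L2dot Omega f g ^+ 2 / L2dot Omega f f.
  by field; rewrite gt_eqF.
by rewrite subr_ge0 ler_pdivrMr// mulrC.
Qed.

End L2_calculus.

(** * Smooth functions *)

Section line_derivative.
Variables (R : realType) (V : normedModType R).
Implicit Types (g : V -> R) (v x : V) (t l : R).

(** Reduces directional derivatives to one-variable calculus on a line, where the chain rule
    applies. *)
Lemma is_derive_line g v x t l :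
  is_derive (t *: v + x) v g l <-> is_derive t 1 (fun s : R => g (s *: v + x)) l.
Proof.
have E : (fun h : R => h^-1 *: ((g \o shift (t *: v + x)) (h *: v) - g (t *: v + x))) =
   (fun h : R => h^-1 *: (((fun s : R => g (s *: v + x)) \o shift t) (h *: (1 : R)) -
     g (t *: v + x))).
  apply/funext => h /=; congr (_ *: (g _ - _)).
  by rewrite scalerDl addrA -[h *: 1]/(h * 1) mulr1.
split=> -[dg gl]; split.
- by move: dg; rewrite /derivable E.
- by move: gl; rewrite /derive E.
- by move: dg; rewrite /derivable E.
- by move: gl; rewrite /derive E.
Qed.

End line_derivative.

Section flat_function.
Variable R : realType.
Implicit Types (P : {poly R}) (x : R).

(* Closed under differentiation, see is_derive_flat; [flat 1] is the usual smooth
   function vanishing exactly on the negative half-line. *)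
Definition flat P x : R := if 0 < x then P.[x^-1] * expR (- x^-1) else 0.

Lemma flat_le0 P x : x <= 0 -> flat P x = 0.
Proof. by move=> x0; rewrite /flat ltNge x0. Qed.

(** This serves differentiability at 0. The exponential beats every power: y^(n+1) <= (n+1)! e^y at
    y = 1/x. The factor X^n added for the induction on [P] absorbs the X of the Horner step P * X +
    c. *)
Lemma flat_bound P : exists2 C, 0 <= C & forall x, `|flat P x| <= C * `|x|.
Proof.
suff H n : exists2 C, 0 <= C & forall x, `|flat (P * 'X^n) x| <= C * `|x|.
  by have [C C0 HC] := H 0%N; exists C => // x; rewrite -[P]mulr1 -(expr0 'X).
elim/poly_ind : P n => [n|P c IH n].
  by exists 0 => // x; rewrite mul0r /flat horner0 mul0r if_same normr0.
have [C C0 HC] := IH n.+1.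
exists (C + `|c| * (n.+1)`!%:R); first by rewrite addr_ge0// mulr_ge0.
move=> x; have -> : flat ((P * 'X + c%:P) * 'X^n) x =
    flat (P * 'X^(n.+1)) x + c * flat ('X^n) x.
  rewrite /flat; case: ifP => _; last by rewrite mulr0 addr0.
  by rewrite !(hornerM, hornerD, hornerXn, hornerX, hornerC) exprS; ring.
rewrite (le_trans (ler_normD _ _))// mulrDl lerD// normrM -mulrA ler_wpM2l//.
rewrite /flat; case: ltP => [x0|_]; last by rewrite normr0 mulr_ge0.
rewrite hornerXn gtr0_norm; last by rewrite mulr_gt0 ?expR_gt0// exprn_gt0// invr_gt0.
rewrite (gtr0_norm x0).
have y0 : 0 < x^-1 by rewrite invr_gt0.
rewrite expRN -ler_pdivlMr ?invr_gt0 ?expR_gt0// invrK.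
rewrite -(ler_pM2l y0) -exprS.
have -> : x^-1 * ((n.+1)`!%:R * x * expR x^-1) = (n.+1)`!%:R * expR x^-1.
  by rewrite [_ * x]mulrC -!mulrA mulKf ?gt_eqF.
rewrite mulrC -ler_pdivrMr ?ltr0n ?fact_gt0//.
by apply: le_trans (expR_ge1Dxn n (ltW y0)); rewrite lerDr.
Qed.

(** For x > 0 the derivative is (P - P')(1/x) x^-2 e^(-1/x), and x^-2 is X^2 evaluated at 1/x. *)
Lemma is_derive_flat P x : is_derive x 1 (flat P) (flat ('X^2 * (P - P^`())) x).
Proof.
have [x0|x0|->] := ltgtP x 0.
- rewrite flat_le0 ?ltW//.
  apply: (@near_eq_is_derive R R R (cst (0 : R))).
  by near=> y; rewrite flat_le0//; apply: ltW; near: y; exact: lt_nbhsl.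
- apply: (@near_eq_is_derive R R R (fun y => P.[y^-1] * expR (- y^-1))).
    near=> y; rewrite /flat ifT//; near: y; exact: lt_nbhsr.
  have xn0 : x != 0 by rewrite gt_eqF.
  have dV : is_derive x 1 (fun y : R => y^-1) (- x ^- 2).
    by have := is_deriveV xn0 (is_derive_id x (1 : R)); rewrite [_ *: _]mulr1.
  have dP := is_derive1_comp (is_derive_poly P x^-1) dV.
  have dN : is_derive x 1 (fun y : R => - y^-1) (- - x ^- 2) := is_deriveN dV.
  have dE := @is_derive1_comp R expR (fun y => - y^-1) x _ _ (is_derive_expR _) dN.
  have h := is_deriveM dP dE.
  rewrite (_ : flat _ x = P.[x^-1] * (expR (- x^-1) * (- - x ^- 2)) +
     expR (- x^-1) * (P^`().[x^-1] * (- x ^- 2))); first exact: h.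
  rewrite /flat x0 !(hornerM, hornerXn, hornerD, hornerN) hornerX opprK expr2 invfM.
  by ring.
- rewrite flat_le0//.
  have [C C0 HC] := flat_bound (P * 'X).
  have lim0 : h^-1 *: ((flat P \o shift 0) (h *: (1:R)) - flat P 0) @[h --> 0^'] --> (0 : R).
    apply/cvgrPdist_le => e e0.
    near=> h; rewrite sub0r normrN /= addr0 [h *: 1]mulr1 (@flat_le0 _ 0)// subr0.
    (* The difference quotient at 0 is again a flat function, and [flat_bound] makes it O(h). *)
    have -> : h^-1 *: flat P h = flat (P * 'X) h.
      by rewrite /flat; case: ifP => _; [rewrite hornerMX [LHS]mulrC; ring|rewrite scaler0].
    apply: (le_trans (HC h)).
    have : `|h| <= e / (C + 1).
      near: h; apply: dnbhs0_le; by rewrite divr_gt0// ltr_wpDl.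
    rewrite ler_pdivlMr ?ltr_wpDl// => he.
    by apply: le_trans he; rewrite mulrC ler_wpM2l// lerDl.
  split; first by apply/cvg_ex; exists 0.
  exact: cvg_lim lim0.
Unshelve. all: by end_near. Qed.

Lemma flat1_ge0 x : 0 <= flat 1 x.
Proof. by rewrite /flat; case: ifP => // _; rewrite hornerC mul1r expR_ge0. Qed.

Lemma flat1_gt0 x : 0 < x -> 0 < flat 1 x.
Proof. by move=> x0; rewrite /flat x0 hornerC mul1r expR_gt0. Qed.

Lemma flat1_le1 x : flat 1 x <= 1.
Proof.
rewrite /flat; case: ifP => // x0.
by rewrite hornerC mul1r expR_le1 oppr_le0 invr_ge0 ltW.
Qed.

Lemma flat1_natmul_cvg x : flat 1 (n%:R * x) @[n --> \oo] --> (\1_(`]0, +oo[%classic) x : R).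
Proof.
rewrite indicE; have [x0|x0] := ltP 0 x; last first.
  rewrite memNset; last by rewrite /= in_itv/= andbT => /lt_geF; rewrite x0.
  by under eq_fun do rewrite flat_le0 ?mulr_ge0_le0//; exact: cvg_cst.
rewrite mem_set; last by rewrite /= in_itv/= andbT.
rewrite -[true%:R]/(1 : R).
apply/cvgrPdist_le => e e0; near=> n.
have n0 : 0 < n%:R :> R by rewrite ltr0n; near: n; exact: nbhs_infty_gt.
rewrite /flat mulr_gt0// hornerC mul1r ger0_norm ?subr_ge0; last first.
  by rewrite expR_le1 oppr_le0 invr_ge0 ltW// mulr_gt0.
have := expR_ge1Dx (- (n%:R * x)^-1).
suff : (n%:R * x)^-1 <= e by lra.
rewrite -[leRHS]invrK lef_pV2 ?posrE ?mulr_gt0 ?invr_gt0// -ler_pdivrMr//.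
near: n; exact: nbhs_infty_ger.
Unshelve. all: by end_near. Qed.

End flat_function.

Section smooth_functions.
Variables (R : realType) (d : nat).
Implicit Types (f g : 'rV[R]_d -> R) (P : {poly R}).

Lemma is_derive_classical_partial i f x : differentiable f x ->
  is_derive x (delta_mx ord0 i) f (classical_partial i f x).
Proof. by move=> df; apply: derivableP; exact: diff_derivable. Qed.

Lemma CkS k f : Ck k.+1 f -> Ck k f.
Proof.
elim: k f => [f [df _] x|k IH f [df pf]]; first exact: differentiable_continuous.
by split => // i; apply: IH; exact: pf.
Qed.

Lemma Ck_cst k (c : R) : Ck k (cst c : 'rV[R]_d -> R).
Proof.
elim: k c => [c x|k IH c]; first exact: cst_continuous.
split=> [x|i]; first exact: differentiable_cst.
rewrite (_ : classical_partial i _ = cst 0)//.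
by apply/funext => x; rewrite /classical_partial derive_cst.
Qed.

Lemma CkD k f g : Ck k f -> Ck k g -> Ck k (f + g).
Proof.
elim: k f g => [f g cf cg x|k IH f g [df pf] [dg pg]].
  by apply: continuousD; [exact: cf|exact: cg].
split=> [x|i]; first exact: differentiableD.
rewrite (_ : classical_partial i _ = classical_partial i f + classical_partial i g).
  by apply: IH; [exact: pf|exact: pg].
by apply/funext => x; rewrite /classical_partial deriveD//; exact: diff_derivable.
Qed.

Lemma classical_partialM i f g : (forall x, differentiable f x) ->
  (forall x, differentiable g x) ->
  classical_partial i (f * g) = f * classical_partial i g + g * classical_partial i f.
Proof.
by move=> df dg; apply/funext => x; rewrite /classical_partial deriveM//; exact: diff_derivable.
Qed.

Lemma CkM k f g : Ck k f -> Ck k g -> Ck k (f * g).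
Proof.
elim: k f g => [f g cf cg x|k IH f g Cf Cg].
  by apply: continuousM; [exact: cf|exact: cg].
have [df pf] := Cf; have [dg pg] := Cg.
split=> [x|i]; first exact: differentiableM.
rewrite classical_partialM//.
by apply: CkD; apply: IH; [exact: CkS|exact: pg|exact: CkS|exact: pf].
Qed.

Lemma Ck_prod k (I : Type) (r : seq I) (F : I -> 'rV[R]_d -> R) :
  (forall i, Ck k (F i)) -> Ck k (\prod_(i <- r) F i).
Proof.
move=> CF; elim/big_ind : _ => //; first exact: Ck_cst.
by move=> f g; exact: CkM.
Qed.

(** The affine argument covers both faces of a box as well as the steps approximating orthants. [P]
    is generalized in the induction because each derivative changes the polynomial. *)
Lemma Ck_flat k P i (c e : R) : Ck k (fun x : 'rV[R]_d => flat P (c * x ord0 i + e)).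
Proof.
have daff (x : 'rV[R]_d) : differentiable (fun x : 'rV[R]_d => c * x ord0 i + e) x.
  apply: differentiableD; last exact: differentiable_cst.
  by apply: differentiableM; [exact: differentiable_cst|exact: differentiable_coord].
have dflat Q x : differentiable (flat Q) x.
  by apply/derivable1_diffP; case: (is_derive_flat Q x).
have dfa Q x : differentiable (fun x : 'rV[R]_d => flat Q (c * x ord0 i + e)) x.
  exact: (@differentiable_comp _ _ _ _ (fun x : 'rV[R]_d => c * x ord0 i + e)).
elim: k P => [P x|k IH P]; first exact: differentiable_continuous.
split=> // j.
rewrite (_ : classical_partial j _ = cst (c * (i == j)%:R) *
   (fun x : 'rV[R]_d => flat ('X^2 * (P - P^`())) (c * x ord0 i + e))).
  by apply: CkM; [exact: Ck_cst|exact: IH].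
apply/funext => x; apply: derive_val.
rewrite -[x in is_derive x]add0r -[0](scale0r (delta_mx ord0 j)); apply/is_derive_line.
pose G s : R := c * (i == j)%:R * s + (c * x ord0 i + e).
have dG : is_derive (0 : R) 1 G (c * (i == j)%:R).
  by apply: is_derive_eq; rewrite addr0 [_%:A]mulr1.
have -> : (fun s : R => flat P (c * (s *: delta_mx ord0 j + x) ord0 i + e)) = flat P \o G.
  apply/funext => s /=; rewrite /G; congr flat.
  by rewrite !mxE eqxx/=; ring.
have h := is_derive1_comp (is_derive_flat P (G 0)) dG.
rewrite (_ : (_ * _) x = flat ('X^2 * (P - P^`())) (G 0) * (c * (i == j)%:R))//.
by rewrite /G mulr0 add0r mulrC.
Qed.

End smooth_functions.

(** * Compactly supported continuous functions and test functions *)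

Section compactly_supported.
Variable R : realType.

Definition cube n (L : R) : set 'rV[R]_n := [set x | forall i, `|x ord0 i| <= L].

Lemma cube_closed_box n L : cube L = [set x : 'rV[R]_n | forall i, `[- L, L]%classic (x ord0 i)].
Proof. by apply/seteqP; split => x /= xL i; have := xL i; rewrite in_itv/= ler_norml. Qed.

Lemma compact_cube n L : compact (@cube n L).
Proof.
by rewrite cube_closed_box; apply: (@rV_compact R n (fun=> `[- L, L]%classic)) => _; exact: segment_compact.
Qed.

Lemma measurable_cube n L : measurable (@cube n L).
Proof.
rewrite cube_closed_box.
by apply: (@measurable_bigcap_coord _ _ (fun=> `[- L, L]%classic)) => i; exact: measurable_itv.
Qed.

Lemma lebesgue_cube_lty n L : (lebesgue_rV R n (cube L) < +oo)%E.
Proof.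
elim: n => [|n IH]; first by rewrite /= diracE; case: (_ \in _); rewrite ltry.
rewrite /= /leb_cons /pushforward.
have -> : @rV_cons R n @^-1` cube L = `[- L, L]%classic `*` cube L.
  apply/seteqP; split => [[a x] /= xL|[a x] [/= aL xL] i].
    split; first by have := xL (lshift n (ord0 : 'I_1)); rewrite rV_consEl in_itv/= ler_norml.
    by move=> i; have := xL (rshift 1 i); rewrite rV_consEr.
  have [j ->|j ->] := @split_ordP 1 n i; last by rewrite rV_consEr; exact: xL.
  by rewrite rV_consEl /= ler_norml; move: aL; rewrite in_itv.
rewrite /= product_measure1E//; last exact: measurable_cube.
rewrite lte_mul_pinfty//.
have h : (lebesgue_measure ([set` `[(- L), L]%R] : set R) < +oo)%E.
  by rewrite lebesgue_measure_itv/=; case: ifP; rewrite ?ltry.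
by rewrite ge0_fin_numE.
Qed.

(** The support is confined to a cube because slicing a cube along the first coordinate gives cubes
    again, which suits induction on the dimension. *)
Definition Cc n (f : 'rV[R]_n -> R) : Prop :=
  continuous f /\ exists L, forall x, ~ cube L x -> f x = 0.

Section Cc_theory.
Variable n : nat.
Implicit Types f g : 'rV[R]_n -> R.
Local Notation mu := (lebesgue_rV R n).

Lemma Cc_bounded f : Cc f -> exists2 M, 0 <= M & forall x, `|f x| <= M.
Proof.
move=> [cf [L fL]].
have /compact_bounded[M [_ fM]] : compact (f @` cube L).
  by apply: continuous_compact; [exact: continuous_subspaceT|exact: compact_cube].
exists (`|M| + 1) => [|x]; first by rewrite addr_ge0.
have [xL|xL] := pselect (cube L x); last by rewrite fL// normr0 addr_ge0.
by apply: fM; [rewrite ltr_pwDr// ler_norm|exists x].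
Qed.

Lemma Cc_measurable f : Cc f -> measurable_fun setT f.
Proof. by case=> cf _; exact: continuous_rV_measurable. Qed.

Lemma Cc_integrable f : Cc f -> mu.-integrable setT (EFin \o f).
Proof.
move=> Cf; have [M M0 fM] := Cc_bounded Cf; have [_ [L fL]] := Cf.
apply: (@le_integrable _ _ _ _ _ _ _ (EFin \o (fun x => M * \1_(cube L) x))) => //.
- by apply/measurable_EFinP; exact: Cc_measurable.
- move=> x _ /=; rewrite lee_fin [leRHS]ger0_norm ?mulr_ge0// indicE.
  have [xL|xL] := pselect (cube L x); first by rewrite mem_set// mulr1.
  by rewrite fL// normr0 mulr_ge0.
- rewrite (_ : _ \o _ = (fun x => M%:E * (EFin \o \1_(cube L)) x)%E)//.
  apply: integrableZl => //; apply/integrableP; split.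
    by apply/measurable_EFinP; apply: measurable_indic; exact: measurable_cube.
  under eq_integral do rewrite /= ger0_norm//.
  by rewrite integral_indic ?setIT//; [exact: lebesgue_cube_lty|exact: measurable_cube].
Qed.

Lemma CcM f g : Cc f -> continuous g -> Cc (f * g).
Proof.
move=> [cf [L fL]] cg; split; last by exists L => x /fL fx; rewrite mulrfctE fx mul0r.
by move=> x; apply: continuousM; [exact: cf|exact: cg].
Qed.

Lemma Cc_norm f : Cc f -> Cc (fun x => `|f x|).
Proof.
move=> [cf [L fL]]; split; last by exists L => x /fL ->; rewrite normr0.
by move=> x; apply: continuous_comp; [exact: cf|exact: norm_continuous].
Qed.

End Cc_theory.

Section test_functions.
Variables (n : nat) (Omega : set 'rV[R]_n).
Hypothesis oOmega : open Omega.
Implicit Types phi psi : 'rV[R]_n -> R.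

Lemma test_fun_Cc phi : test_fun Omega phi -> Cc phi.
Proof.
move=> [Cphi [K [cK _ phiK]]]; split; first exact: (Cphi 0%N).
have [M [_ KM]] := compact_bounded cK.
exists (`|M| + 1) => x xM; apply: phiK; apply: contra_not xM => /KM xM i.
have /xM : M < `|M| + 1 by rewrite ltr_pwDr// ler_norm.
apply: le_trans.
rewrite [leRHS]/Num.norm/= mx_normrE.
exact: (le_bigmax _ (fun ij : 'I_1 * 'I_n => `|x ij.1 ij.2|) (ord0, i)).
Qed.

Lemma test_fun_L2 phi : test_fun Omega phi -> L2 Omega phi.
Proof.
move=> tphi; have Cphi := test_fun_Cc tphi.
have mO := open_rV_measurable oOmega.
apply/L2P => //; split.
  by apply: measurable_funTS; exact: Cc_measurable.
apply: (integrableS measurableT) => //.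
have := Cc_integrable (CcM Cphi (proj1 Cphi)).
by congr (_.-integrable _ _); apply/funext => x.
Qed.

Lemma test_funM phi psi : test_fun Omega phi -> (forall k, Ck k psi) ->
  test_fun Omega (phi * psi).
Proof.
move=> [Cphi [K [cK KO phiK]]] Cpsi; split; first by move=> k; exact: CkM.
by exists K; split => // x /phiK h; rewrite mulrfctE h mul0r.
Qed.

Lemma test_fun_partial i phi : test_fun Omega phi ->
  test_fun Omega (classical_partial i phi).
Proof.
move=> [Cphi [K [cK KO phiK]]]; split; first by move=> k; have [_ h] := Cphi k.+1; exact: h.
exists K; split => // x xK.
have h : is_derive x (delta_mx ord0 i) phi 0.
  apply: (@near_eq_is_derive R _ _ (cst (0 : R))).
  have oK : open (~` K) by apply: closed_openC; exact: compact_closed cK.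
  by have := open_nbhs_nbhs (conj oK xK); apply: filterS => y /phiK ->.
exact: derive_val.
Qed.

End test_functions.

End compactly_supported.

(** * The fundamental lemma of the calculus of variations *)

Section orthants.
Variables (R : realType) (n : nat).
Implicit Types (a x : 'rV[R]_n).

(** Orthants are closed under intersection and generate the sigma-algebra, as Dynkin's theorem
    requires, and their indicators are products of one-variable ones, which are easy to smooth. *)
Definition orthant a : set 'rV[R]_n := [set x | forall i, a ord0 i < x ord0 i].

Lemma measurable_orthant a : measurable (orthant a).
Proof.
rewrite (_ : orthant a = [set x | forall i, `]a ord0 i, +oo[%classic (x ord0 i)]).
  apply: (@measurable_bigcap_coord _ _ (fun i => `]a ord0 i, +oo[%classic)) => i.
  exact: measurable_itv.
by apply/seteqP; split => x /= ax i; have := ax i; rewrite in_itv/= andbT.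
Qed.

Lemma orthantI a b : orthant a `&` orthant b = orthant (\row_i Num.max (a ord0 i) (b ord0 i)).
Proof.
apply/seteqP; split => [x [ax bx] i|x abx]; first by rewrite mxE gt_max ax bx.
by split=> i; have := abx i; rewrite mxE gt_max => /andP[].
Qed.

Lemma half_space_orthants i (c : R) : [set x : 'rV[R]_n | c < x ord0 i] =
  \bigcup_(k : nat) orthant (\row_j if j == i then c else - k%:R).
Proof.
apply/seteqP; split => [x /= cx|x [k _ /(_ i)]]; last by rewrite mxE eqxx.
pose M := \big[Num.max/0]_j `|x ord0 j|.
(* Any natural number above all the |x_j| places x in the orthant. *)
exists (Num.trunc M).+1 => // j; rewrite mxE; case: eqVneq => [->//|_].
rewrite ltrNl; apply: le_lt_trans (ler_norm _) _; rewrite normrN.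
apply: le_lt_trans (truncnS_gt M).
exact: (le_bigmax _ (fun j => `|x ord0 j|) j).
Qed.

Lemma measurable_rV_orthants :
  @measurable _ 'rV[R]_n = <<s range orthant >>.
Proof.
apply/seteqP; split; last first.
  apply: smallest_sub; first exact: sigma_algebra_measurable.
  by move=> _ [a _ <-]; exact: measurable_orthant.
apply: smallest_sub; first exact: smallest_sigma_algebra.
move=> Y; rewrite -bigcup_seq/= => -[i _ [A mA <-]].
have mc : measurable_fun setT
    ((fun x => x ord0 i) : g_sigma_algebraType (range orthant) -> measurableTypeR R).
  apply: (measurability _ (RGenOInfty.measurableE R)) => _ [_ [c ->] <-].
  rewrite setTI (_ : _ @^-1` _ = [set x : 'rV[R]_n | c < x ord0 i]); last first.
    by apply/seteqP; split => x /=; rewrite in_itv/= andbT.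
  rewrite half_space_orthants; apply: bigcup_measurable => k _.
  by apply: sub_sigma_algebra; exists (\row_j if j == i then c else - k%:R).
exact: mc.
Qed.

End orthants.

Section null_on_orthants.
Variables (R : realType) (n : nat).
Local Notation mu := (lebesgue_rV R n).
Local Open Scope ereal_scope.

(** The sets on which [F] integrates to 0 form a Dynkin system: integrability gives countable
    disjoint unions, and the vanishing total integral gives complements. *)
Lemma ae_eq0_of_orthants (F : 'rV[R]_n -> \bar R) : mu.-integrable setT F ->
  \int[mu]_x F x = 0 -> (forall a, \int[mu]_(x in orthant a) F x = 0) ->
  ae_eq mu setT F (cst 0).
Proof.
move=> iF F0 oF; have mF := measurable_int _ iF.
apply: integral_ae_eq => // E _ mE; rewrite integral0.
move: mE; rewrite (measurable_rV_orthants R n).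
apply: (@dynkin_induction _ 'rV[R]_n (range (@orthant R n))
  (fun E => \int[mu]_(x in E) F x = 0)) => //.
- exact: measurable_rV_orthants.
- move=> _ _ [a _ <-] [b _ <-]; rewrite orthantI.
  by exists (\row_i Num.max (a ord0 i) (b ord0 i)).
- by move=> _ [a _ <-]; exact: oF.
- move=> S mS S0.
  have := integral_setU mu mS (measurableC mS).
  rewrite setUv => /(_ _ mF); rewrite F0 S0 add0e => <- //.
  exact/disj_setPCl.
- move=> G mG tG G0; rewrite integral_bigcup//.
    by rewrite eseries0// => i _ _; exact: G0.
  by apply: (integrableS measurableT) => //; exact: bigcupT_measurable.
Qed.

End null_on_orthants.

Section fundamental_lemma.
Variables (R : realType) (n : nat) (Omega : set 'rV[R]_n).
Hypothesis oOmega : open Omega.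
Local Notation mu := (lebesgue_rV R n).
Implicit Types (p : {ffun 'I_n -> rat * rat}).

Let mOmega : measurable Omega. Proof. exact: open_rV_measurable. Qed.

(** The factors keep the affine shape that [Ck_flat] expects. Only the sign inside the box and the
    support matter, so there is no normalization. *)
Definition bump p : 'rV[R]_n -> R := \prod_(i < n)
  ((fun x : 'rV[R]_n => flat 1 (1 * x ord0 i + (- ratr (p i).1))) *
   (fun x : 'rV[R]_n => flat 1 (-1 * x ord0 i + ratr (p i).2))).

Lemma fct_prodE (I : Type) (r : seq I) (F : I -> 'rV[R]_n -> R) x :
  (\prod_(i <- r) F i) x = \prod_(i <- r) F i x.
Proof. by elim: r => [|i r IH]; rewrite ?big_nil// !big_cons -IH. Qed.

Lemma bump_gt0 p x : box p x -> 0 < bump p x.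
Proof.
move=> xp; rewrite /bump fct_prodE; apply: prodr_gt0 => i _.
by have /andP[? ?] := xp i; apply: mulr_gt0; apply: flat1_gt0; lra.
Qed.

Lemma bump_eq0 p x : ~ cbox p x -> bump p x = 0.
Proof.
move=> xp; apply/eqP; rewrite /bump fct_prodE; apply/prodf_eq0.
have /existsNP[i /negP] := xp; rewrite negb_and -!ltNge => xi.
exists i => //; rewrite mulrfctE mulf_eq0.
by case/orP: xi => xi; apply/orP; [left|right]; rewrite flat_le0 ?eqxx//; lra.
Qed.

Lemma compact_cbox p : compact (@cbox R n p).
Proof.
rewrite (_ : cbox p = [set x | forall i, `[ratr (p i).1, ratr (p i).2]%classic (x ord0 i)]).
  apply: (@rV_compact R n (fun i => `[ratr (p i).1, ratr (p i).2]%classic)) => i.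
  exact: segment_compact.
by apply/seteqP; split => x /= xp i; have := xp i; rewrite in_itv.
Qed.

Lemma test_fun_bump p : cbox p `<=` Omega -> test_fun Omega (bump p).
Proof.
move=> pO; split; last first.
  by exists (cbox p); split => //; [exact: compact_cbox|exact: bump_eq0].
by move=> k; apply: Ck_prod => i; apply: CkM; exact: Ck_flat.
Qed.

Definition step (a : 'rV[R]_n) (k : nat) : 'rV[R]_n -> R :=
  \prod_(i < n) (fun x : 'rV[R]_n => flat 1 (k%:R * x ord0 i + (- (k%:R * a ord0 i)))).

Lemma Ck_step a k j : Ck j (step a k).
Proof. by apply: Ck_prod => i; exact: Ck_flat. Qed.

Lemma step_ge0_le1 a k x : 0 <= step a k x <= 1.
Proof.
rewrite /step fct_prodE; apply/andP; split.
  by apply: prodr_ge0 => i _; exact: flat1_ge0.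
by apply: prodr_ile1 => i _; rewrite flat1_ge0 flat1_le1.
Qed.

Lemma step_cvg a x : step a k x @[k --> \oo] --> (\1_(orthant a) x : R).
Proof.
have -> : \1_(orthant a) x = \prod_(i < n) \1_(`]0, +oo[%classic) (x ord0 i - a ord0 i) :> R.
  rewrite indicE; have [xa|xa] := boolP (x \in orthant a).
    rewrite big1// => i _; rewrite indicE mem_set//= in_itv/= andbT subr_gt0.
    by move: xa; rewrite inE => /(_ i).
  apply/esym/eqP/prodf_eq0.
  have /existsNP[i xi] : ~ forall i, a ord0 i < x ord0 i.
    by move=> h; move/negP: xa; apply; rewrite inE.
  exists i => //; rewrite indicE memNset ?eqxx// => h; apply: xi.
  by move: h; rewrite /= in_itv/= andbT subr_gt0.
have h : \prod_(i < n) flat 1 (k%:R * (x ord0 i - a ord0 i)) @[k --> \oo] -->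
    (\prod_(i < n) \1_(`]0, +oo[%classic) (x ord0 i - a ord0 i) : R).
  apply: cvg_big => [|i _]; last exact: flat1_natmul_cvg.
  exact: mul_continuous.
apply: cvg_trans h; apply: near_eq_cvg; near=> k.
by rewrite /step fct_prodE; apply: eq_bigr => i _; rewrite mulrBr.
Unshelve. all: by end_near. Qed.

(* As [k] grows, [bump p * step a k] stays a test function and [step a k] tends to
   the indicator of [orthant a]; hence [g * bump p] integrates to 0 over all
   orthants, which generate the sigma-algebra. *)
Lemma fundamental_lemma g : L2 Omega g ->
  (forall phi, test_fun Omega phi -> L2dot Omega g phi = 0) -> ae_eqs Omega g 0.
Proof.
move=> lg g0.
suff : mu.-negligible (Omega `&` [set x | g x != 0]).
  apply: negligibleS => x /=; rewrite not_implyE => -[Ox gx]; split => //.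
  exact/eqP.
apply: negligible_open_cover => // p pO.
have tp := test_fun_bump pO.
pose F := (EFin \o (fun x => g x * bump p x)) \_ Omega.
have iF0 := L2_mul_integrable mOmega lg (test_fun_L2 oOmega tp).
have iF : mu.-integrable setT F by rewrite -integrable_mkcond.
have int_step a k : (\int[mu]_(x in Omega) (g x * bump p x * step a k x)%:E = 0)%E.
  have t : test_fun Omega (bump p * step a k) by apply: test_funM => // j; exact: Ck_step.
  have := g0 _ t; rewrite /L2dot /Rintegral => h.
  rewrite -[LHS]fineK; last first.
    apply: integrable_fin_num => //.
    have := L2_mul_integrable mOmega lg (test_fun_L2 oOmega t).
    by apply: eq_integrable => // x _ /=; rewrite mulrA.
  by congr EFin; rewrite -[RHS]h; congr fine; apply: eq_integral => x _; rewrite mulrA.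
have F0 : (\int[mu]_x F x = 0)%E.
  have := g0 _ tp; rewrite /F -integral_mkcond => h.
  by rewrite -[LHS]fineK ?integrable_fin_num//; congr EFin.
have /negligibleS : ae_eq mu setT F (cst 0%E).
  apply: ae_eq0_of_orthants => // a.
  rewrite /F -integral_mkcondr -/(measurable _).
  pose G k x := (g x * bump p x * step a k x)%:E.
  have mstep k : measurable_fun Omega (step a k).
    by apply: measurable_funTS; apply: continuous_rV_measurable; exact: (Ck_step a k 0).
  have : (\int[mu]_(x in Omega) G k x @[k --> \oo] -->
     \int[mu]_(x in Omega) (g x * bump p x * \1_(orthant a) x)%:E)%E.
    (* The steps lie between 0 and 1, so |g * bump| dominates for all [k]. *)
    apply: (@dominated_cvg _ _ _ _ _ mOmega G _
       (fun x => `|(g x * bump p x)%:E|%E)).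
    - move=> k; apply/measurable_EFinP; apply: measurable_funM => //.
      by apply/measurable_EFinP; exact: measurable_int iF0.
    - move=> x _; apply: cvg_EFin; first by near=> k.
      by apply: cvgM; [exact: cvg_cst|exact: step_cvg].
    - by move=> x _.
    - exact: integrable_abse.
    - move=> k x _; rewrite /G /= lee_fin normrM.
      have /andP[s0 s1] := step_ge0_le1 a k x.
      by rewrite (ger0_norm s0) ler_piMr.
  rewrite (_ : (fun k => \int[mu]_(x in Omega) G k x)%E = cst 0%E); last first.
    by apply/funext => k; rewrite int_step.
  move/(cvg_unique _ (cvg_cst _)) => /(_ (@ereal_hausdorff R)) h.
  rewrite setIC integral_mkcondr h; apply: eq_integral => x _.
  rewrite /patch indicE; case: ifP => _; by rewrite ?mulr1 ?mulr0.
apply => x [xp gx] /= h.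
have := h I; rewrite /F /patch mem_set/=; last by apply: pO; exact: box_cbox.
by case=> /eqP; rewrite mulf_eq0 (negbTE gx) gt_eqF// bump_gt0.
Unshelve. all: by end_near. Qed.

End fundamental_lemma.

(** * Integration by parts *)

Section rV_cons_theory.
Variables (R : realType) (n : nat).
Implicit Types (s t : R) (y : 'rV[R]_n) (f g : 'rV[R]_n.+1 -> R).
Local Notation cons s y := (@rV_cons R n (s, y)).
Local Notation lam := (@lebesgue_measure R).
Local Notation mu := (lebesgue_rV R n).

Definition ord0S : 'I_n.+1 := lshift n (ord0 : 'I_1).
Definition ordS (j : 'I_n) : 'I_n.+1 := rshift 1 j.

Lemma ord_consP (i : 'I_n.+1) : i = ord0S \/ exists j, i = ordS j.
Proof.
have [j ->|j ->] := @split_ordP 1 n i; last by right; exists j.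
by left; apply: val_inj; rewrite /= ord1.
Qed.

Lemma rV_cons0 s y : cons s y ord0 ord0S = s.
Proof. exact: rV_consEl. Qed.

Lemma rV_consS s y j : cons s y ord0 (ordS j) = y ord0 j.
Proof. exact: rV_consEr. Qed.

Lemma rV_consP (x : 'rV[R]_n.+1) s y :
  x ord0 ord0S = s -> (forall j, x ord0 (ordS j) = y ord0 j) -> x = cons s y.
Proof.
move=> x0 xS; apply/rowP => i.
by have [->|[j ->]] := ord_consP i; rewrite ?rV_cons0 ?rV_consS.
Qed.

Lemma continuous_cons : continuous (fun p : R * 'rV[R]_n => cons p.1 p.2).
Proof.
move=> -[s y] A /nbhs_ballP[e /= e0 eA]; apply/nbhs_ballP; exists e => //.
move=> [t z] [/= st yz]; apply: eA; split => // i j; rewrite ord1.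
have [->|[k ->]] := ord_consP j; first by rewrite !rV_cons0.
by rewrite !rV_consS; have [_] := yz; apply.
Qed.

Lemma continuous_consl y : continuous (fun s : R => cons s y).
Proof.
move=> s A /(@continuous_cons (s, y))/nbhs_ballP[e /= e0 eA]; apply/nbhs_ballP.
by exists e => // t st; apply: (eA (t, y)); split => //; exact: ballxx.
Qed.

Lemma continuous_consr s : continuous (fun y : 'rV[R]_n => cons s y).
Proof.
move=> y A /(@continuous_cons (s, y))/nbhs_ballP[e /= e0 eA]; apply/nbhs_ballP.
by exists e => // z yz; apply: (eA (s, z)); split => //; exact: ballxx.
Qed.

Lemma cube_cons L s y : cube L (cons s y) <-> `|s| <= L /\ cube L y.
Proof.
split=> [sy|[sL yL] i].
  by split=> [|i]; [have := sy ord0S; rewrite rV_cons0|have := sy (ordS i); rewrite rV_consS].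
by have [->|[j ->]] := ord_consP i; rewrite ?rV_cons0 ?rV_consS.
Qed.

Lemma Cc_consr f s : Cc f -> Cc (fun y => f (cons s y)).
Proof.
move=> [cf [L fL]]; split.
  move=> y; apply: (@continuous_comp _ _ _ (fun y => cons s y) f); last exact: cf.
  exact: continuous_consr.
exists L => y yL; apply: fL => /cube_cons[_]; exact: yL.
Qed.

Lemma continuous_Cc_consl f y : Cc f -> continuous (fun s => f (cons s y)).
Proof.
move=> [cf _] s; apply: (@continuous_comp _ _ _ (fun s => cons s y) f); last exact: cf.
exact: continuous_consl.
Qed.

Lemma is_derive_cons0 f s y l : is_derive (cons s y) (delta_mx ord0 ord0S) f l ->
  is_derive s 1 (fun t => f (cons t y)) l.
Proof.
have E t : cons t y = t *: delta_mx ord0 ord0S + cons 0 y.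
  apply/esym/rV_consP; first by rewrite mxE [X in X + _]mxE [X in _ * X + _]mxE !eqxx/= mulr1 rV_cons0 addr0.
  by move=> j; rewrite mxE [X in X + _]mxE [X in _ * X + _]mxE/= mulr0 rV_consS add0r.
rewrite {1}E => /is_derive_line.
by congr (is_derive _ _ _ _); apply/funext => t; rewrite E.
Qed.

Lemma is_derive_consS f s y j l : is_derive (cons s y) (delta_mx ord0 (ordS j)) f l ->
  is_derive y (delta_mx ord0 j) (fun y => f (cons s y)) l.
Proof.
rewrite -[cons s y]add0r -(scale0r (delta_mx ord0 (ordS j))) => /is_derive_line h.
suff : is_derive (0 *: delta_mx ord0 j + y) (delta_mx ord0 j) (fun y => f (cons s y)) l.
  by rewrite scale0r add0r.
apply/is_derive_line.
move: h; congr (is_derive _ _ _ _); apply/funext => t; congr f.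
apply: rV_consP; first by rewrite mxE [X in X + _]mxE [X in _ * X + _]mxE/= mulr0 add0r rV_cons0.
by move=> k; rewrite mxE [X in X + _]mxE [X in _ * X + _]mxE [RHS]mxE [X in _ = X + _]mxE [X in _ = _ * X + _]mxE/= rV_consS.
Qed.

Local Open Scope ereal_scope.

Lemma ge0_integral_cons (F : 'rV[R]_n.+1 -> \bar R) :
  measurable_fun setT F -> (forall x, 0 <= F x) ->
  \int[lebesgue_rV R n.+1]_x F x = \int[(lam \x mu)%E]_p F (rV_cons p).
Proof.
move=> mF F0.
by have := ge0_integral_pushforward (@measurable_rV_cons R n) (lam \x mu) measurableT mF
  (fun z _ => F0 z); rewrite preimage_setT.
Qed.

Lemma ge0_integral_cons1 (F : 'rV[R]_n.+1 -> \bar R) :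
  measurable_fun setT F -> (forall x, 0 <= F x) ->
  \int[lebesgue_rV R n.+1]_x F x = \int[lam]_s \int[mu]_y F (cons s y).
Proof.
move=> mF F0; rewrite ge0_integral_cons// fubini_tonelli1//.
by apply: measurableT_comp => //; exact: measurable_rV_cons.
Qed.

Lemma ge0_integral_cons2 (F : 'rV[R]_n.+1 -> \bar R) :
  measurable_fun setT F -> (forall x, 0 <= F x) ->
  \int[lebesgue_rV R n.+1]_x F x = \int[mu]_y \int[lam]_s F (cons s y).
Proof.
move=> mF F0; rewrite ge0_integral_cons// fubini_tonelli2//.
by apply: measurableT_comp => //; exact: measurable_rV_cons.
Qed.

Lemma integrable_cons (F : 'rV[R]_n.+1 -> \bar R) :
  (lebesgue_rV R n.+1).-integrable setT F ->
  (lam \x mu).-integrable setT (F \o @rV_cons R n).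
Proof.
move=> /integrableP[mF iF]; apply/integrableP; split.
  by apply: measurableT_comp => //; exact: measurable_rV_cons.
by rewrite ge0_integral_cons in iF => //; exact: measurableT_comp.
Qed.

Lemma integral_cons (F : 'rV[R]_n.+1 -> \bar R) :
  (lebesgue_rV R n.+1).-integrable setT F ->
  \int[lebesgue_rV R n.+1]_x F x = \int[(lam \x mu)%E]_p F (rV_cons p).
Proof.
move=> iF; have iF' := integrable_cons iF.
by have := integral_pushforward (@measurable_rV_cons R n) (measurable_int _ iF) iF' measurableT;
  rewrite preimage_setT.
Qed.

End rV_cons_theory.

Section ftc_compact_support.
Variables (R : realType) (G H : R -> R) (L : R).
Hypotheses (cH : continuous H) (dG : forall t : R, is_derive t 1 G (H t))
  (GL : forall t, L < `|t| -> G t = 0).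
Local Notation lam := (@lebesgue_measure R).

Let HL t : L < `|t| -> H t = 0.
Proof.
move=> tL; have h : is_derive t 1 G 0.
  apply: (@near_eq_is_derive R R R (cst (0 : R))).
  near=> s; rewrite GL//; near: s.
  have : `|s| @[s --> t] --> `|t| by exact: norm_continuous.
  by move/cvgr_gt; apply.
by rewrite -(@derive_val _ _ _ _ _ _ _ (dG t)) (@derive_val _ _ _ _ _ _ _ h).
Unshelve. all: by end_near. Qed.

Let cG : continuous G.
Proof.
by move=> t; apply: differentiable_continuous; apply/derivable1_diffP; case: (dG t).
Qed.

Let FTC a b : a < b -> (\int[lam]_(t in `[a, b]) (H t)%:E = (G b)%:E - (G a)%:E)%E.
Proof.
move=> ab; apply: continuous_FTC2 => //.
- by apply: continuous_subspaceT => x; exact: cH.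
- split; first by move=> t _; case: (dG t).
    by apply: cvg_at_right_filter; exact: cG.
  by apply: cvg_at_left_filter; exact: cG.
- by move=> t _; rewrite derive1E; exact: derive_val.
Qed.

Lemma integral_derive_compact : (\int[lam]_t (H t)%:E = 0)%E.
Proof.
(* Beyond the support on both sides, so that [G] vanishes at both ends of [-M, M]. *)
pose M := `|L| + 1.
have LM : L < M by rewrite ltr_pwDr// ler_norm.
have M0 : 0 < M by rewrite ltr_pwDr.
have := @FTC (- M) M; rewrite GL ?GL ?normrN ?gtr0_norm// subee// => <-; last lra.
rewrite [RHS]integral_mkcond; apply: eq_integral => t _; rewrite /patch/=.
case: ifPn => //; rewrite notin_setE/= in_itv/= => tM; rewrite HL//.
rewrite (lt_trans LM)// ltNge; apply/negP => ?; apply: tM.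
by rewrite -ler_norml.
Qed.

(** [G t] is the integral of [H] from a point to the left of the support; [M] in the proof exceeds
    both [L] and |t|. This is the source of all the Sobolev-type bounds below. *)
Lemma le_integral_derive_compact t : (`|G t|%:E <= \int[lam]_t `|H t|%:E)%E.
Proof.
pose M := Num.max `|L| `|t| + 1.
have LM : L < M by rewrite ltr_pwDr// le_max ler_norm.
have tM : `|t| < M by rewrite ltr_pwDr// le_max lexx orbT.
have M0 : 0 < M by rewrite (le_lt_trans _ tM).
have /FTC : - M < t by have := tM; rewrite ltr_norml => /andP[].
have -> : G (- M) = 0 by rewrite GL// normrN gtr0_norm.
rewrite sube0 => h.
have mH : measurable_fun setT (H : R -> measurableTypeR R) by exact: continuous_measurable_fun.
rewrite (_ : `|G t|%:E = `|(G t)%:E|)%E// -h.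
apply: le_trans (le_abse_integral _ _ _) _ => //.
  by apply/measurable_EFinP; exact: measurable_funTS.
rewrite /=; apply: ge0_subset_integral => //.
by apply/measurable_EFinP; exact: measurableT_comp.
Qed.

End ftc_compact_support.

Section integration_by_parts.
Variable R : realType.

(** By Fubini one may integrate first along the first coordinate or over the remaining ones. If [i]
    is the first coordinate, the inner integrals vanish by the one-variable result; otherwise they
    vanish by induction on the slices. *)
Lemma integral_derive_Cc n (i : 'I_n) (f g : 'rV[R]_n -> R) : Cc f -> Cc g ->
  (forall x, is_derive x (delta_mx ord0 i) f (g x)) ->
  (\int[lebesgue_rV R n]_x (g x)%:E = 0)%E.
Proof.
elim: n i f g => [[]//|n IH] i f g Cf Cg dfg.
have iF := Cc_integrable Cg.
rewrite (@integral_cons R n (EFin \o g))//.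
have [i0|[j ij]] := ord_consP i.
  rewrite -(integral21_prod_meas1 (integrable_cons iF)) /fubini_G.
  apply: integral0_eq => y _ /=; have [_ [L fL]] := Cf.
  apply: (@integral_derive_compact R (fun s => f (@rV_cons R n (s, y))) _ L).
  - exact: continuous_Cc_consl.
  - by move=> t; apply: is_derive_cons0; rewrite -i0.
  - by move=> t tL; apply: fL => /cube_cons[]; rewrite leNgt tL.
rewrite -(integral12_prod_meas1 (integrable_cons iF)) /fubini_F.
apply: integral0_eq => s _ /=.
apply: (IH j (fun y => f (@rV_cons R n (s, y)))) => [||y].
- exact: Cc_consr.
- exact: Cc_consr.
- by apply: is_derive_consS; rewrite -ij.
Qed.

Variables (n : nat) (Omega : set 'rV[R]_n).
Hypothesis oOmega : open Omega.

(** The derivative of [phi * psi] integrates to 0, since the product has compact support in [Omega]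
    and there is no boundary term. *)
Lemma test_fun_weak_partial i phi : test_fun Omega phi ->
  is_weak_partial Omega i phi (classical_partial i phi).
Proof.
move=> tphi psi tpsi.
have mO := open_rV_measurable oOmega.
have tp := test_funM tphi (proj1 tpsi).
have dphi x : differentiable phi x by have [/(_ 1%N)[]] := tphi.
have dpsi x : differentiable psi x by have [/(_ 1%N)[]] := tpsi.
have := integral_derive_Cc (test_fun_Cc tp) (test_fun_Cc (test_fun_partial i tp))
  (fun x => is_derive_classical_partial i (differentiableM (dphi x) (dpsi x))).
rewrite classical_partialM// => h0.
apply/eqP; rewrite -subr_eq0 opprK; apply/eqP.
have tdp := test_fun_partial i tpsi; have tdq := test_fun_partial i tphi.
rewrite -RintegralD//; [|exact: L2_mul_integrable (test_fun_L2 _ _) (test_fun_L2 _ _)..].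
rewrite -[RHS]/(fine 0%E) -h0 /Rintegral integral_mkcond; congr fine.
apply: eq_integral => x _; rewrite /patch; case: ifPn => [_|].
  by congr EFin; rewrite addrC [in RHS]addrC mulrC.
rewrite notin_setE => xO; congr EFin.
have [_ [K [_ KO phiK]]] := tphi; have [_ [K' [_ KO' dK]]] := tdq.
by rewrite addrfctE !mulrfctE phiK ?dK ?mulr0 ?mul0r ?addr0//; apply: contra_not xO; [exact: KO'|exact: KO].
Qed.

End integration_by_parts.

(** * Weak derivatives *)

Section weak_derivatives.
Variables (R : realType) (d : nat) (Omega : set 'rV[R]_d).
Hypothesis oOmega : open Omega.
Implicit Types (f g phi : 'rV[R]_d -> R) (i : 'I_d).

Let mOmega : measurable Omega. Proof. exact: open_rV_measurable. Qed.

Lemma weak_partial_unique i f g g' : L2 Omega g -> L2 Omega g' ->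
  is_weak_partial Omega i f g -> is_weak_partial Omega i f g' -> ae_eqs Omega g g'.
Proof.
move=> lg lg' wg wg'.
(* The difference is put in the form [-1 *: g' + g] so that the lemmas on linear combinations apply
   to it. *)
have : ae_eqs Omega (-1 *: g' + g) 0.
  apply: (fundamental_lemma oOmega) => [|phi tphi]; first exact: L2_lin.
  rewrite (L2dot_linl mOmega) => //; last exact: test_fun_L2.
  by have := wg _ tphi; rewrite wg'// => /oppr_inj ->; ring.
rewrite /ae_eqs /ae_eq; apply: filterS => x h Ox; have /eqP := h Ox.
by rewrite (_ : (-1 *: g' + g) x = -1 * g' x + g x)// mulN1r addrC subr_eq0 => /eqP.
Qed.

Lemma weak_partial_lin i a f g f' g' :
  L2 Omega f -> L2 Omega g -> L2 Omega f' -> L2 Omega g' ->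
  is_weak_partial Omega i f g -> is_weak_partial Omega i f' g' ->
  is_weak_partial Omega i (a *: f + f') (a *: g + g').
Proof.
move=> lf lg lf' lg' w w' phi tphi.
rewrite !(L2dot_linl mOmega)//; [|exact: test_fun_L2|].
  by rewrite w// w'//; ring.
by apply: test_fun_L2 => //; exact: test_fun_partial.
Qed.

(** Membership in [H1space] supplies a witness, so [xget] does not fall back on its default. *)
Lemma partialP i f : H1space Omega f ->
  L2 Omega (partial Omega i f) /\ is_weak_partial Omega i f (partial Omega i f).
Proof.
move=> [lf /(_ i)[g lg wg]].
by have /(xgetPex 0) : exists g, L2 Omega g /\ is_weak_partial Omega i f g by exists g.
Qed.

Local Opaque partial.

Lemma L2_partial i f : H1space Omega f -> L2 Omega (partial Omega i f).
Proof. by case/(partialP i). Qed.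

Lemma partial_unique i f g : H1space Omega f -> L2 Omega g ->
  is_weak_partial Omega i f g -> ae_eqs Omega (partial Omega i f) g.
Proof. by move=> /(partialP i)[lp wp] lg wg; exact: weak_partial_unique wp wg. Qed.

Lemma H1_lin a f g : H1space Omega f -> H1space Omega g -> H1space Omega (a *: f + g).
Proof.
move=> hf hg; split=> [|i]; first by apply: L2_lin; [|case: hf|case: hg].
have [lf wf] := partialP i hf; have [lg wg] := partialP i hg.
exists (a *: partial Omega i f + partial Omega i g); first exact: L2_lin.
by apply: weak_partial_lin => //; [case: hf|case: hg].
Qed.

(** Equality can be claimed only almost everywhere, because [partial] picks a representative for
    each function independently. *)
Lemma partial_lin i a f g : H1space Omega f -> H1space Omega g ->
  ae_eqs Omega (partial Omega i (a *: f + g)) (a *: partial Omega i f + partial Omega i g).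
Proof.
move=> hf hg; have [lf wf] := partialP i hf; have [lg wg] := partialP i hg.
apply: partial_unique; [exact: H1_lin|exact: L2_lin|].
by apply: weak_partial_lin => //; [case: hf|case: hg].
Qed.

Lemma test_fun_H1 phi : test_fun Omega phi -> H1space Omega phi.
Proof.
move=> tphi; split=> [|i]; first exact: test_fun_L2.
exists (classical_partial i phi); last exact: test_fun_weak_partial.
by apply: test_fun_L2 => //; exact: test_fun_partial.
Qed.

Lemma partial_test_fun i phi : test_fun Omega phi ->
  ae_eqs Omega (partial Omega i phi) (classical_partial i phi).
Proof.
move=> tphi; apply: partial_unique; [exact: test_fun_H1| |exact: test_fun_weak_partial].
by apply: test_fun_L2 => //; exact: test_fun_partial.
Qed.

Lemma L2dot_ae2 f f' g g' : L2 Omega f -> L2 Omega f' -> L2 Omega g -> L2 Omega g' ->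
  ae_eqs Omega f f' -> ae_eqs Omega g g' -> L2dot Omega f g = L2dot Omega f' g'.
Proof.
by move=> lf lf' lg lg' ff gg; rewrite (L2dot_ae mOmega lf lf')// L2dotC (L2dot_ae mOmega lg lg')// L2dotC.
Qed.

(** The squared norm is kept free of roots; the triangle inequality is then replaced by bounds with
    a factor 2. *)
Definition H1sqr f : R := L2dot Omega f f +
  \sum_(i < d) L2dot Omega (partial Omega i f) (partial Omega i f).

Lemma H1normK f : H1norm Omega f ^+ 2 = H1sqr f.
Proof.
rewrite sqr_sqrtr; last by rewrite addr_ge0 ?sqr_ge0// sumr_ge0// => i _; rewrite sqr_ge0.
by rewrite L2normK; congr (_ + _); apply: eq_bigr => i _; rewrite L2normK.
Qed.

Local Opaque L2dot.

(** Parallelogram law: the squares of af + g and -af + g add up to the right-hand side. *)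
Lemma L2dot_lin_le a f g : L2 Omega f -> L2 Omega g ->
  L2dot Omega (a *: f + g) (a *: f + g) <= 2 * a ^+ 2 * L2dot Omega f f + 2 * L2dot Omega g g.
Proof.
move=> lf lg; have := L2dot_ge0 Omega ((- a) *: f + g).
by rewrite !(L2dot_sqr_lin mOmega)// sqrrN; lra.
Qed.

Lemma L2dot_partial_lin_le i a f g : H1space Omega f -> H1space Omega g ->
  L2dot Omega (partial Omega i (a *: f + g)) (partial Omega i (a *: f + g)) <=
  2 * a ^+ 2 * L2dot Omega (partial Omega i f) (partial Omega i f) +
  2 * L2dot Omega (partial Omega i g) (partial Omega i g).
Proof.
move=> hf hg; have e := partial_lin i a hf hg.
have lf := L2_partial i hf; have lg := L2_partial i hg.
have ll := L2_lin mOmega a lf lg.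
rewrite (L2dot_ae2 _ ll _ ll e e); [exact: L2dot_lin_le|exact: L2_partial (H1_lin a hf hg)..].
Qed.

Lemma H1sqr_lin_le a f g : H1space Omega f -> H1space Omega g ->
  H1sqr (a *: f + g) <= 2 * a ^+ 2 * H1sqr f + 2 * H1sqr g.
Proof.
move=> hf hg; have l2 := L2dot_lin_le a hf.1 hg.1.
have key (c x y z u v w : R) : z <= c * x + 2 * y -> w <= c * u + 2 * v ->
    z + w <= c * (x + u) + 2 * (y + v) by lra.
apply: key l2 _; rewrite 2!mulr_sumr -big_split/=; apply: ler_sum => i _.
exact: L2dot_partial_lin_le.
Qed.

Lemma L2dot_le_H1sqr f : L2dot Omega f f <= H1sqr f.
Proof. by rewrite lerDl sumr_ge0// => i _; exact: L2dot_ge0. Qed.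

Lemma L2dot_partial_le_H1sqr i f :
  L2dot Omega (partial Omega i f) (partial Omega i f) <= H1sqr f.
Proof.
rewrite /H1sqr (bigD1 i)//= addrCA lerDl addr_ge0 ?L2dot_ge0//.
by rewrite sumr_ge0// => j _; exact: L2dot_ge0.
Qed.

End weak_derivatives.

(** * Ladyzhenskaya and Poincare inequalities *)

Section product_inequality.
Local Open Scope ereal_scope.
Context d1 d2 (T1 : measurableType d1) (T2 : measurableType d2) (R : realType).
Variables (m1 : {sigma_finite_measure set T1 -> \bar R})
  (m2 : {sigma_finite_measure set T2 -> \bar R}).

(** W^2 is at most A(t) B(s), where A and B are the line integrals of [a] and [b]; each depends on
    one variable only, so the integral of the product factorizes. *)
Lemma integral_sqr_le_prod (W a b : T1 * T2 -> \bar R) :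
  measurable_fun setT W -> measurable_fun setT a -> measurable_fun setT b ->
  (forall p, 0 <= W p) -> (forall p, 0 <= a p) -> (forall p, 0 <= b p) ->
  (forall s t, W (s, t) <= \int[m1]_s' a (s', t)) ->
  (forall s t, W (s, t) <= \int[m2]_t' b (s, t')) ->
  \int[(m1 \x m2)%E]_p (W p * W p) <=
  \int[(m1 \x m2)%E]_p a p * \int[(m1 \x m2)%E]_p b p.
Proof.
move=> mW ma mb W0 a0 b0 Wa Wb.
pose A t := \int[m1]_s a (s, t); pose B s := \int[m2]_t b (s, t).
have A0 t : 0 <= A t by exact: integral_ge0.
have B0 s : 0 <= B s by exact: integral_ge0.
have mA : measurable_fun setT A by exact: measurable_fun_fubini_tonelli_G.
have mB : measurable_fun setT B by exact: measurable_fun_fubini_tonelli_F.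
have IA : \int[(m1 \x m2)%E]_p a p = \int[m2]_t A t by rewrite fubini_tonelli2.
have IB : \int[(m1 \x m2)%E]_p b p = \int[m1]_s B s by rewrite fubini_tonelli1.
have IA0 : 0 <= \int[m2]_t A t by exact: integral_ge0.
rewrite IA IB fubini_tonelli1//; first last.
- by move=> p; exact: mule_ge0.
- exact: emeasurable_funM.
rewrite -ge0_integralZl//; last 1 first.
apply: ge0_le_integral => //.
- by move=> s _; apply: integral_ge0 => t _; exact: mule_ge0.
- apply: measurable_fun_fubini_tonelli_F => //; first exact: emeasurable_funM.
  by move=> p; exact: mule_ge0.
- exact: emeasurable_funM.
move=> s _; rewrite /fubini_F muleC -ge0_integralZl//.
apply: ge0_le_integral => //.
- by move=> t _; exact: mule_ge0.
- apply: emeasurable_funM; apply: measurableT_comp mW _; exact: measurable_pair1.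
- exact: emeasurable_funM.
- by move=> t _; exact: lee_pmul.
Qed.

End product_inequality.

Section slices.
Variable R : realType.
Local Notation lam := (@lebesgue_measure R).
Local Open Scope ereal_scope.

Lemma le_integral_cons0 n (f g : 'rV[R]_n.+1 -> R) s (y : 'rV[R]_n) :
  Cc f -> Cc g -> (forall x, is_derive x (delta_mx ord0 (ord0S n)) f (g x)) ->
  `|f (rV_cons (s, y))|%:E <= \int[lam]_t `|g (rV_cons (t, y))|%:E.
Proof.
move=> Cf Cg dfg; have [_ [L fL]] := Cf.
apply: (@le_integral_derive_compact R (fun s => f (rV_cons (s, y))) _ L).
- exact: continuous_Cc_consl.
- by move=> t; exact: is_derive_cons0.
- by move=> t tL; apply: fL => /cube_cons[]; rewrite leNgt tL.
Qed.

Lemma Cc_abs_measurable n (g : 'rV[R]_n -> R) : Cc g ->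
  measurable_fun setT (fun x => `|g x|%:E).
Proof. by move=> Cg; apply/measurable_EFinP; exact: Cc_measurable (Cc_norm Cg). Qed.

Lemma le_integral_rV1 (f g : 'rV[R]_1 -> R) (x : 'rV[R]_1) :
  Cc f -> Cc g -> (forall x, is_derive x (delta_mx ord0 (ord0S 0)) f (g x)) ->
  `|f x|%:E <= \int[lebesgue_rV R 1]_y `|g y|%:E.
Proof.
move=> Cf Cg dfg.
have -> : x = rV_cons (x ord0 (ord0S 0), 0%R) by apply: rV_consP => // -[].
rewrite ge0_integral_cons1//; last exact: Cc_abs_measurable.
apply: le_trans (le_integral_cons0 _ _ Cf Cg dfg) _.
rewrite le_eqVlt; apply/orP; left; apply/eqP; apply: eq_integral => t _.
(* Lebesgue measure on R^0 is the Dirac mass at its only point, so the inner integral is an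
   evaluation. *)
rewrite integral_dirac//; first by rewrite diracT mul1e.
exact: Cc_abs_measurable (Cc_consr t Cg).
Qed.

(* Ladyzhenskaya's argument with [f] in the role of the square of a function. *)
Lemma integral_sqr_rV2 (f g0 g1 : 'rV[R]_2 -> R) : Cc f -> Cc g0 -> Cc g1 ->
  (forall x, is_derive x (delta_mx ord0 (ord0S 1)) f (g0 x)) ->
  (forall x, is_derive x (delta_mx ord0 (ordS (ord0S 0))) f (g1 x)) ->
  \int[lebesgue_rV R 2]_x (f x ^+ 2)%:E <=
  \int[lebesgue_rV R 2]_x `|g0 x|%:E * \int[lebesgue_rV R 2]_x `|g1 x|%:E.
Proof.
move=> Cf C0 C1 d0 d1.
have mf := Cc_abs_measurable Cf.
have m0 := Cc_abs_measurable C0; have m1 := Cc_abs_measurable C1.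
rewrite (@ge0_integral_cons R 1 (fun x => `|g0 x|%:E))//.
rewrite (@ge0_integral_cons R 1 (fun x => `|g1 x|%:E))//.
rewrite (_ : \int[_]_x _ = \int[lebesgue_rV R 2]_x (`|f x|%:E * `|f x|%:E)); last first.
  by apply: eq_integral => x _; rewrite -EFinM -expr2 real_normK ?num_real.
rewrite (@ge0_integral_cons R 1 (fun x => `|f x|%:E * `|f x|%:E)); last 2 first.
  exact: (emeasurable_funM mf mf).
  by move=> x; rewrite mule_ge0.
have mc (h : 'rV[R]_2 -> \bar R) : measurable_fun setT h ->
    measurable_fun setT (h \o @rV_cons R 1).
  by move=> mh; apply: measurableT_comp => //; exact: measurable_rV_cons.
apply: (@integral_sqr_le_prod _ _ _ _ _ lam (lebesgue_rV R 1) (fun p => `|f (rV_cons p)|%:E)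
  (fun p => `|g0 (rV_cons p)|%:E) (fun p => `|g1 (rV_cons p)|%:E)) => //.
- exact: mc mf.
- exact: mc m0.
- exact: mc m1.
- by move=> s t; exact: le_integral_cons0.
- move=> s t; apply: (@le_integral_rV1 (fun y => f (rV_cons (s, y)))).
  + exact: Cc_consr.
  + exact: Cc_consr.
  + by move=> y; apply: is_derive_consS.
Qed.

Lemma Cc_L2 n (f : 'rV[R]_n -> R) : Cc f -> L2 setT f.
Proof.
move=> Cf; apply/L2P => //; split; first exact: Cc_measurable.
have := Cc_integrable (CcM Cf (proj1 Cf)).
by congr (_.-integrable _ _).
Qed.

Lemma integral_CcM n (f g : 'rV[R]_n -> R) : Cc f -> Cc g ->
  \int[lebesgue_rV R n]_x (f x * g x)%:E = (L2dot setT f g)%:E.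
Proof.
by move=> Cf Cg; rewrite fineK// integrable_fin_num//; exact: L2_mul_integrable (Cc_L2 _) (Cc_L2 _).
Qed.

(** Cauchy-Schwarz for [2 * (f * g)], which is the derivative of f^2 when [g] is that of [f]; this
    is where 4 = 2^2 comes from. *)
Lemma integral_abs_CcM_sqr n (f g : 'rV[R]_n -> R) : Cc f -> Cc g ->
  (\int[lebesgue_rV R n]_x `|2 * (f x * g x)|%:E) ^+ 2 <=
  4%:E * (\int[lebesgue_rV R n]_x (f x ^+ 2)%:E * \int[lebesgue_rV R n]_x (g x ^+ 2)%:E).
Proof.
move=> Cf Cg.
have Cf' := Cc_norm Cf; have Cg' := Cc_norm Cg.
have sq (h : 'rV[R]_n -> R) : Cc h -> \int[lebesgue_rV R n]_x (h x ^+ 2)%:E =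
    (L2dot setT (fun x => `|h x|)%R (fun x => `|h x|)%R)%:E.
  move=> Ch; rewrite -integral_CcM; [|exact: Cc_norm..].
  by apply: eq_integral => x _; rewrite -expr2 real_normK ?num_real.
rewrite !sq//.
have -> : \int[lebesgue_rV R n]_x `|2 * (f x * g x)|%:E =
    (2 * L2dot setT (fun x => `|f x|)%R (fun x => `|g x|)%R)%:E.
  rewrite EFinM -integral_CcM// -ge0_integralZl//.
  - by apply: eq_integral => x _; rewrite -EFinM !normrM ger0_norm.
  - apply/measurable_EFinP; exact: Cc_measurable (CcM Cf' (proj1 Cg')).
rewrite -EFin_expe -!EFinM lee_fin exprMn -natrX.
by rewrite ler_pM2l//; apply: L2_cauchy_schwarz => //; exact: Cc_L2.
Qed.

End slices.

Section sobolev_poincare.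
Variable R : realType.
Local Notation lam := (@lebesgue_measure R).
Local Open Scope ereal_scope.

Lemma Cc_integralE n (f : 'rV[R]_n -> R) : Cc f ->
  exists r : R, \int[lebesgue_rV R n]_x (f x)%:E = r%:E.
Proof.
by move=> Cf; exists (fine (\int[lebesgue_rV R n]_x (f x)%:E)); rewrite fineK// integrable_fin_num//; exact: Cc_integrable.
Qed.

Lemma Cc_sqr n (f : 'rV[R]_n -> R) : Cc f -> Cc (fun x => f x ^+ 2)%R.
Proof. by move=> Cf; have := CcM Cf (proj1 Cf). Qed.

Lemma Cc_2mul n (f g : 'rV[R]_n -> R) : Cc f -> Cc g -> Cc (fun x => 2 * (f x * g x))%R.
Proof.
move=> Cf Cg; have := CcM (CcM Cf (proj1 Cg)) (@cst_continuous _ _ (2%R : R)).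
by congr Cc; apply/funext => x; rewrite mulrC.
Qed.

Lemma is_derive_sqr n (f h : 'rV[R]_n -> R) i :
  (forall x, is_derive x (delta_mx ord0 i) f (h x)) ->
  forall x, is_derive x (delta_mx ord0 i) (fun x => f x ^+ 2)%R (2 * (f x * h x))%R.
Proof.
move=> dh x; rewrite mulr_natl mulr2n.
have d := is_deriveM (dh x) (dh x); exact: d.
Qed.

(** Trades extended-real integrals for real numbers, so that the estimates below end in real
    arithmetic. *)
Lemma abs_CcM_integralE n (f g : 'rV[R]_n -> R) (X Y : R) : Cc f -> Cc g ->
  \int[lebesgue_rV R n]_x (f x ^+ 2)%:E = X%:E ->
  \int[lebesgue_rV R n]_x (g x ^+ 2)%:E = Y%:E ->
  exists G : R, [/\ \int[lebesgue_rV R n]_x `|2 * (f x * g x)|%:E = G%:E,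
    (0 <= G)%R, (0 <= X)%R, (0 <= Y)%R & (G ^+ 2 <= 4 * (X * Y))%R].
Proof.
move=> Cf Cg EX EY.
have [G EG] := Cc_integralE (Cc_norm (Cc_2mul Cf Cg)).
exists G; split => //.
- by rewrite -lee_fin -EG; apply: integral_ge0 => x _; rewrite lee_fin.
- by rewrite -lee_fin -EX; apply: integral_ge0 => x _; rewrite lee_fin sqr_ge0.
- by rewrite -lee_fin -EY; apply: integral_ge0 => x _; rewrite lee_fin sqr_ge0.
- by have := integral_abs_CcM_sqr Cf Cg; rewrite EX EY EG -EFin_expe -!EFinM lee_fin.
Qed.

(* On each slice [x0 = s] the planar inequality and Cauchy-Schwarz bound the
   integral of [f^4] by [2 |f(s, .)|^2 (|h1(s, .)|^2 + |h2(s, .)|^2)], and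
   [|f(s, .)|^2] is bounded uniformly in [s] by the integral of [|2 f h0|]. *)
Lemma integral_pow4_rV3 (f h0 h1 h2 : 'rV[R]_3 -> R) :
  Cc f -> Cc h0 -> Cc h1 -> Cc h2 ->
  (forall x, is_derive x (delta_mx ord0 (ord0S 2)) f (h0 x)) ->
  (forall x, is_derive x (delta_mx ord0 (ordS (ord0S 1))) f (h1 x)) ->
  (forall x, is_derive x (delta_mx ord0 (ordS (ordS (ord0S 0)))) f (h2 x)) ->
  \int[lebesgue_rV R 3]_x (f x ^+ 4)%:E <=
  2%:E * \int[lebesgue_rV R 3]_x `|2 * (f x * h0 x)|%:E *
   (\int[lebesgue_rV R 3]_x (h1 x ^+ 2)%:E + \int[lebesgue_rV R 3]_x (h2 x ^+ 2)%:E).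
Proof.
move=> Cf C0 C1 C2 d0 d1 d2.
have Cg0 := Cc_2mul Cf C0.
have [M EM] := Cc_integralE (Cc_norm Cg0).
have M0 : (0 <= M)%R by rewrite -lee_fin -EM; apply: integral_ge0 => x _; rewrite lee_fin.
have mE (g : 'rV[R]_3 -> R) : Cc g -> measurable_fun setT (EFin \o g).
  by move=> Cg; apply/measurable_EFinP; exact: Cc_measurable.
have m1 := mE _ (Cc_sqr C1); have m2 := mE _ (Cc_sqr C2).
rewrite EM -ge0_integralD//; try by move=> x _; rewrite lee_fin sqr_ge0.
rewrite -EFinM -ge0_integralZl//; first last.
- by rewrite lee_fin mulr_ge0.
- by move=> x _; rewrite adde_ge0// lee_fin sqr_ge0.
- exact: emeasurable_funD.
have mS : measurable_fun [set: 'rV[R]_3]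
   (fun x => (2 * M)%:E * ((h1 x ^+ 2)%:E + (h2 x ^+ 2)%:E)).
  by apply: measurable_funeM; exact: emeasurable_funD.
have S0 (x : 'rV[R]_3) : 0 <= (2 * M)%:E * ((h1 x ^+ 2)%:E + (h2 x ^+ 2)%:E).
  by rewrite mule_ge0 ?adde_ge0// lee_fin ?sqr_ge0// mulr_ge0.
have C4 : Cc (fun x => f x ^+ 4)%R.
  have := Cc_sqr (Cc_sqr Cf); congr Cc; apply/funext => x; by rewrite -exprM.
have f40 (x : 'rV[R]_3) : 0 <= (f x ^+ 4)%:E by rewrite lee_fin (exprM _ 2 2) sqr_ge0.
rewrite ge0_integral_cons1//; last exact: mE C4.
rewrite [leRHS]ge0_integral_cons1//.
have mcons (F : 'rV[R]_3 -> \bar R) : measurable_fun setT F ->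
    measurable_fun setT (F \o @rV_cons R 2).
  by move=> mF; apply: measurableT_comp => //; exact: measurable_rV_cons.
apply: ge0_le_integral => //.
- by move=> s _; apply: integral_ge0 => y _; exact: f40.
- apply: (measurable_fun_fubini_tonelli_F (fun p => (f (rV_cons p) ^+ 4)%:E)).
    exact: mcons (mE _ C4).
  by move=> p; exact: f40.
- apply: (measurable_fun_fubini_tonelli_F (fun p => (2 * M)%:E *
    ((h1 (rV_cons p) ^+ 2)%:E + (h2 (rV_cons p) ^+ 2)%:E))).
    exact: mcons mS.
  by move=> p; exact: S0.
move=> s _.
have Cfs := Cc_consr s Cf; have C1s := Cc_consr s C1; have C2s := Cc_consr s C2.
have [P EP] := Cc_integralE (Cc_sqr Cfs).
have [Q1 EQ1] := Cc_integralE (Cc_sqr C1s).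
have [Q2 EQ2] := Cc_integralE (Cc_sqr C2s).
have [G1 [EG1 G10 P0 Q10 GP1]] := abs_CcM_integralE Cfs C1s EP EQ1.
have [G2 [EG2 G20 _ Q20 GP2]] := abs_CcM_integralE Cfs C2s EP EQ2.
have PM : (P <= M)%R.
  rewrite -lee_fin -EP -EM [leRHS]ge0_integral_cons2//; last first.
    exact: Cc_abs_measurable Cg0.
  apply: ge0_le_integral => //.
  - by move=> y _; rewrite lee_fin sqr_ge0.
  - by apply/measurable_EFinP; exact: Cc_measurable (Cc_sqr Cfs).
  - apply: (measurable_fun_fubini_tonelli_G
      (fun p => `|2 * (f (rV_cons p) * h0 (rV_cons p))|%:E)) => //.
    exact: mcons (mE _ (Cc_norm Cg0)).
  - move=> y _; have := le_integral_cons0 s y (Cc_sqr Cf) Cg0 (is_derive_sqr d0).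
    by rewrite ger0_norm// sqr_ge0.
have := integral_sqr_rV2 (Cc_sqr Cfs) (Cc_2mul Cfs C1s) (Cc_2mul Cfs C2s)
  (is_derive_sqr (fun y => is_derive_consS (d1 (rV_cons (s, y)))))
  (is_derive_sqr (fun y => is_derive_consS (d2 (rV_cons (s, y))))).
rewrite EG1 EG2 -EFinM => h.
rewrite (_ : \int[lebesgue_rV R 2]_y (f (rV_cons (s, y)) ^+ 4)%:E =
   \int[lebesgue_rV R 2]_x ((f (rV_cons (s, x)) ^+ 2) ^+ 2)%:E); last first.
  by apply: eq_integral => y _; rewrite -exprM.
apply: le_trans h _.
rewrite ge0_integralZl//; first last.
- by rewrite lee_fin mulr_ge0.
- by move=> y _; rewrite adde_ge0// lee_fin sqr_ge0.
- by apply: emeasurable_funD; apply/measurable_EFinP; exact: Cc_measurable (Cc_sqr _).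
rewrite ge0_integralD//; try by move=> y _; rewrite lee_fin sqr_ge0.
- rewrite EQ1 EQ2 -EFinD -EFinM lee_fin.
  (* G1 G2 <= (G1^2 + G2^2) / 2 <= 2 P (Q1 + Q2), and then P <= M. *)
  have := sqr_ge0 (G1 - G2).
  have : (P * (Q1 + Q2) <= M * (Q1 + Q2))%R by rewrite ler_wpM2r// addr_ge0.
  by lra.
- by apply/measurable_EFinP; exact: Cc_measurable (Cc_sqr _).
- by apply/measurable_EFinP; exact: Cc_measurable (Cc_sqr _).
Qed.

(** On each line f^2 is at most the integral of |2 f h|; integrating over |s| <= L gives X <= 2 L G.
    With G^2 <= 4 X Y this is X^2 <= 16 L^2 X Y, and X cancels unless it is 0. *)
Lemma poincare_Cc n (f h : 'rV[R]_n.+1 -> R) (L X Y : R) : Cc f -> Cc h -> (0 < L)%R ->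
  (forall x, ~ cube L x -> f x = 0%R) ->
  (forall x, is_derive x (delta_mx ord0 (ord0S n)) f (h x)) ->
  \int[lebesgue_rV R n.+1]_x (f x ^+ 2)%:E = X%:E ->
  \int[lebesgue_rV R n.+1]_x (h x ^+ 2)%:E = Y%:E ->
  (X <= 16 * L ^+ 2 * Y)%R.
Proof.
move=> Cf Ch L0 fL dh EX EY.
have [G [EG G0 X0 Y0 GP]] := abs_CcM_integralE Cf Ch EX EY.
have Cg := Cc_2mul Cf Ch; have mg := Cc_abs_measurable Cg.
have mcons (F : 'rV[R]_n.+1 -> \bar R) : measurable_fun setT F ->
    measurable_fun setT (F \o @rV_cons R n).
  by move=> mF; apply: measurableT_comp => //; exact: measurable_rV_cons.
have XG : (X <= 2 * L * G)%R.
  rewrite -lee_fin -EX EFinM -EG.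
  have mf2 : measurable_fun [set: 'rV[R]_n.+1] (fun x => (f x ^+ 2)%:E).
    by apply/measurable_EFinP; exact: Cc_measurable (Cc_sqr Cf).
  rewrite ge0_integral_cons2//; last by move=> x; rewrite lee_fin sqr_ge0.
  rewrite ge0_integral_cons2//.
  have mA : measurable_fun setT (fun y : 'rV[R]_n =>
      \int[lam]_t `|2 * (f (rV_cons (t, y)) * h (rV_cons (t, y)))|%:E).
    apply: (measurable_fun_fubini_tonelli_G
      (fun p => `|2 * (f (rV_cons p) * h (rV_cons p))|%:E)) => //.
    exact: mcons mg.
  rewrite -ge0_integralZl//; first last.
  - by rewrite lee_fin mulr_ge0// ltW.
  - by move=> y _; exact: integral_ge0.
  apply: ge0_le_integral => //.
  - by move=> y _; apply: integral_ge0 => s _; rewrite lee_fin sqr_ge0.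
  - apply: (measurable_fun_fubini_tonelli_G (fun p => (f (rV_cons p) ^+ 2)%:E)).
      exact: mcons mf2.
    by move=> p; rewrite lee_fin sqr_ge0.
  - exact: measurable_funeM.
  move=> y _; pose A := \int[lam]_t `|2 * (f (rV_cons (t, y)) * h (rV_cons (t, y)))|%:E.
  rewrite -/A.
  have A0 : 0 <= A by exact: integral_ge0.
  (* [A] does not depend on s and [f] vanishes for |s| > L, so integrating the pointwise bound over
     s costs the length 2 L. *)
  have -> : (2 * L)%:E * A = \int[lam]_(s in `[(- L)%R, L]) A.
    have lL : lam (`[(- L)%R, L]%classic : set R) = (2 * L)%:E.
      by rewrite lebesgue_measure_itv/= lte_fin ifT; [rewrite -EFinD; congr EFin; ring|lra].
    by rewrite muleC integral_cst//; congr (_ * _); exact: esym lL.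
  rewrite [leRHS]integral_mkcond.
  apply: ge0_le_integral => //.
  - by move=> s _; rewrite lee_fin sqr_ge0.
  - apply/measurable_EFinP; apply: continuous_measurable_fun.
    exact: (continuous_Cc_consl (Cc_sqr Cf)).
  - apply/(measurable_restrictT (fun=> A) (measurable_itv `[(- L)%R, L])).
    exact: measurable_cst.
  - move=> s _; rewrite /patch; case: ifPn => [_|].
      have := le_integral_cons0 s y (Cc_sqr Cf) Cg (is_derive_sqr dh).
      by rewrite ger0_norm// sqr_ge0.
    rewrite notin_setE/= in_itv/= => sL; rewrite fL ?expr0n// => /cube_cons[+ _].
    by rewrite ler_norml.
have [->|X1] := eqVneq X 0%R; first by rewrite !mulr_ge0// ltW// exprn_gt0.
have Xp : (0 < X)%R by rewrite lt_neqAle eq_sym X1.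
rewrite -(ler_pM2l Xp) -expr2.
have : (X ^+ 2 <= (2 * L * G) ^+ 2)%R by rewrite ler_sqr ?nnegrE// mulr_ge0// mulr_ge0// ltW.
move=> /le_trans; apply; rewrite exprMn.
have -> : (X * (16 * L ^+ 2 * Y) = (2 * L) ^+ 2 * (4 * (X * Y)))%R by ring.
by rewrite ler_wpM2l// sqr_ge0.
Qed.

End sobolev_poincare.

(** * From test functions to H10: truncation and density *)

Section pow4_truncation.
Variable R : realFieldType.

(** The distance of [f] to [p] enters only squared, so an L2 approximation is enough. With a =
    min(|f|, k) > |p|, factoring gives (a^2 - p^2)^2 <= (2k)^2 (f - p)^2, and a^4 <= 2 (a^2 - p^2)^2
    + 2 p^4 because (a^2 - 2 p^2)^2 >= 0. *)
Lemma pow4_min_le (k f p : R) : 0 <= k ->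
  Num.min `|f| k ^+ 4 <= 8 * k ^+ 2 * (f - p) ^+ 2 + 2 * p ^+ 4.
Proof.
move=> k0; set a := Num.min _ _.
have a0 : 0 <= a by rewrite le_min normr_ge0.
have ak : a <= k by rewrite ge_min lexx orbT.
have af : a <= `|f| by rewrite ge_min lexx.
have p4 : p ^+ 4 = `|p| ^+ 4 by rewrite !(exprM _ 2 2) real_normK ?num_real.
have fp : (`|f| - `|p|) ^+ 2 <= (f - p) ^+ 2.
  rewrite -[leRHS]real_normK ?num_real// -[leLHS]real_normK ?num_real//.
  by rewrite ler_sqr ?nnegrE//; exact: ler_dist_dist.
have [ap|pa] := leP a `|p|.
  apply: (@le_trans _ _ (`|p| ^+ 4)); first by rewrite lerXn2r ?nnegrE.
  rewrite p4; have := exprn_ge0 4 (normr_ge0 p).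
  have : 0 <= 8 * k ^+ 2 * (f - p) ^+ 2 by apply: mulr_ge0; [apply: mulr_ge0|]; rewrite ?sqr_ge0.
  lra.
have p0 : 0 <= `|p| by [].
have h1 : (a ^+ 2 - `|p| ^+ 2) ^+ 2 <= 4 * k ^+ 2 * (f - p) ^+ 2.
  rewrite subr_sqr exprMn mulrC; apply: ler_pM; rewrite ?sqr_ge0//.
    rewrite -[4]/(2 * 2)%:R natrM -expr2 -exprMn ler_sqr ?nnegrE ?addr_ge0 ?mulr_ge0//; lra.
  apply: le_trans fp; rewrite ler_sqr ?nnegrE; lra.
have -> : a ^+ 4 = (a ^+ 2) ^+ 2 by rewrite -exprM.
rewrite p4 (_ : `|p| ^+ 4 = (`|p| ^+ 2) ^+ 2); last by rewrite -exprM.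
have := sqr_ge0 (a ^+ 2 - 2 * `|p| ^+ 2); lra.
Qed.

(** Here [k2] is k^2, [x] and [N] are the squared L2 and H1 norms of the approximation error, and 2
    [z] bounds the integral of the fourth power of the test function. *)
Lemma truncation_bound (k2 x N z : R) : k2 * x <= k2 * N -> k2 * N <= 1 ->
  8 * k2 * x + 2 * (2 * z) <= 8 + 4 * z.
Proof. lra. Qed.

(** With f = h + phi: [x], [y], [z] are the squared L2 norms of f, h, phi, while [D], [c], [b] are
    those of their first partial derivatives; [N] is the squared H1 norm of h and [l] is L^2. *)
Lemma approximation_bound (e x y z b c D N l : R) :
  0 <= l -> N * (2 + 64 * l) <= e ->
  x <= 2 * 1 ^+ 2 * y + 2 * z -> z <= 16 * l * b -> b <= 2 * (-1) ^+ 2 * c + 2 * D ->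
  y <= N -> c <= N -> x <= 64 * l * D + e.
Proof.
move=> l0 H1 H2 H3 H4 H5 H6.
have : l * b <= l * (2 * (-1) ^+ 2 * c + 2 * D) by rewrite ler_wpM2l.
have : l * c <= l * N by rewrite ler_wpM2l.
lra.
Qed.

End pow4_truncation.

Section H10_theory.
Variables (R : realType) (d : nat) (Omega : set 'rV[R]_d).
Hypothesis oOmega : open Omega.
Implicit Types (f g phi : 'rV[R]_d -> R) (i : 'I_d).
Local Notation mu := (lebesgue_rV R d).

Let mOmega : measurable Omega. Proof. exact: open_rV_measurable. Qed.

Lemma test_fun_eq0 phi x : test_fun Omega phi -> ~ Omega x -> phi x = 0.
Proof. by move=> [_ [K [_ KO phiK]]] xO; apply: phiK; apply: contra_not xO; exact: KO. Qed.

Lemma test_fun_integral_sqr phi : test_fun Omega phi ->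
  (\int[mu]_x (phi x ^+ 2)%:E = (L2dot Omega phi phi)%:E)%E.
Proof.
move=> tphi; have Cphi := test_fun_Cc tphi.
rewrite -[RHS]/(EFin _) /L2dot Rintegral_mkcond.
rewrite (_ : (fun x => phi x * phi x) \_ Omega = (fun x => phi x * phi x)); last first.
  apply/funext => x; rewrite /patch; case: ifPn => //; rewrite notin_setE => xO.
  by rewrite test_fun_eq0// mul0r.
exact: (integral_CcM Cphi Cphi).
Qed.

Local Opaque partial L2dot.

Lemma test_fun_is_derive i phi x : test_fun Omega phi ->
  is_derive x (delta_mx ord0 i) phi (classical_partial i phi x).
Proof. by move=> [/(_ 1%N)[dphi _] _]; exact: is_derive_classical_partial. Qed.

Lemma test_fun_partialK i phi : test_fun Omega phi ->
  L2dot Omega (partial Omega i phi) (partial Omega i phi) =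
  L2dot Omega (classical_partial i phi) (classical_partial i phi).
Proof.
move=> tphi; have e := partial_test_fun oOmega i tphi.
have lp := L2_partial i (test_fun_H1 oOmega tphi).
have lc := test_fun_L2 oOmega (test_fun_partial i tphi).
exact: L2dot_ae2.
Qed.

(** The two decompositions at the end are phrased as linear combinations: one transfers a bound from
    [phi] to [f], the other controls norms of [phi] by those of [f]. *)
Lemma H10_approx f eps : H10space Omega f -> 0 < eps ->
  exists h phi, [/\ test_fun Omega phi, H1space Omega h, H1sqr Omega h < eps ^+ 2,
    f = 1 *: h + phi & phi = -1 *: h + f].
Proof.
move=> [hf df] e0; have [phi tphi fphi] := df _ e0.
have hphi := test_fun_H1 oOmega tphi.
exists (f - phi), phi; split => //.
- by rewrite (_ : f - phi = -1 *: phi + f); [exact: H1_lin|rewrite scaleN1r addrC].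
- by rewrite -H1normK ltrXn2r// sqrtr_ge0.
- by rewrite scale1r subrK.
- by rewrite scaleN1r opprB subrK.
Qed.

Lemma test_fun_abs_integral i phi : test_fun Omega phi ->
  exists G, [/\ (\int[mu]_x `|2 * (phi x * classical_partial i phi x)|%:E = G%:E)%E,
    0 <= G & G <= H1sqr Omega phi].
Proof.
move=> tphi; have tp := test_fun_partial i tphi.
have [G [EG G0 X0 Y0 GP]] := abs_CcM_integralE (test_fun_Cc tphi) (test_fun_Cc tp)
  (test_fun_integral_sqr tphi) (test_fun_integral_sqr tp).
exists G; split => //.
apply: (@le_trans _ _ (L2dot Omega phi phi + L2dot Omega (classical_partial i phi) (classical_partial i phi))).
  rewrite -ler_sqr ?nnegrE ?addr_ge0//; apply: le_trans GP _.
  by have := sqr_ge0 (L2dot Omega phi phi - L2dot Omega (classical_partial i phi) (classical_partial i phi)); lra.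
rewrite /H1sqr (bigD1 i)//= -test_fun_partialK// lerD2l lerDl.
by rewrite sumr_ge0// => j _; exact: L2dot_ge0.
Qed.

Lemma test_fun_partial2_le i j phi : test_fun Omega phi -> j != i ->
  L2dot Omega (classical_partial i phi) (classical_partial i phi) +
  L2dot Omega (classical_partial j phi) (classical_partial j phi) <= H1sqr Omega phi.
Proof.
move=> tphi ij; rewrite -(test_fun_partialK i tphi) -(test_fun_partialK j tphi).
rewrite /H1sqr (bigD1 i)//= (bigD1 j)//=.
rewrite addrA addrCA lerDl addr_ge0//; first exact: L2dot_ge0.
by rewrite sumr_ge0// => k _; exact: L2dot_ge0.
Qed.

End H10_theory.

Section sobolev_test_functions.
Variable R : realType.
Local Opaque partial L2dot.

(** The planar argument yields N^2; the constant 2 is that of dimension 3, so that both dimensions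
    share one statement. *)
Lemma test_fun_pow4_2 (Omega : set 'rV[R]_2) phi : open Omega -> test_fun Omega phi ->
  (\int[lebesgue_rV R 2]_x (phi x ^+ 4)%:E <= (2 * (H1sqr Omega phi) ^+ 2)%:E)%E.
Proof.
move=> oO tphi; set N := H1sqr Omega phi.
have Cphi := test_fun_Cc tphi.
have Cp i := test_fun_Cc (test_fun_partial i tphi).
have dp i x := test_fun_is_derive i x tphi.
have [G0 [E0 G00 GN0]] := test_fun_abs_integral oO (ord0S 1) tphi.
have [G1 [E1 G10 GN1]] := test_fun_abs_integral oO (ordS (ord0S 0)) tphi.
have := integral_sqr_rV2 (Cc_sqr Cphi) (Cc_2mul Cphi (Cp _)) (Cc_2mul Cphi (Cp _))
  (is_derive_sqr (dp _)) (is_derive_sqr (dp _)).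
rewrite E0 E1 -EFinM; under eq_integral do rewrite -exprM.
move/le_trans; apply; rewrite lee_fin.
have : G0 * G1 <= N * N by exact: ler_pM.
have := sqr_ge0 N; rewrite expr2; lra.
Qed.

Lemma test_fun_pow4_3 (Omega : set 'rV[R]_3) phi : open Omega -> test_fun Omega phi ->
  (\int[lebesgue_rV R 3]_x (phi x ^+ 4)%:E <= (2 * (H1sqr Omega phi) ^+ 2)%:E)%E.
Proof.
move=> oO tphi; set N := H1sqr Omega phi.
have Cphi := test_fun_Cc tphi.
have tp i := test_fun_partial i tphi.
have dp i x := test_fun_is_derive i x tphi.
have [G0 [E0 G00 GN0]] := test_fun_abs_integral oO (ord0S 2) tphi.
have := integral_pow4_rV3 Cphi (test_fun_Cc (tp _)) (test_fun_Cc (tp _)) (test_fun_Cc (tp _))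
  (dp _) (dp _) (dp _).
rewrite E0 !(test_fun_integral_sqr (tp _)) -EFinD -!EFinM.
move/le_trans; apply; rewrite lee_fin -mulrA ler_wpM2l// expr2; apply: ler_pM => //.
  by rewrite addr_ge0// L2dot_ge0.
exact: test_fun_partial2_le.
Qed.

End sobolev_test_functions.

Section H10_embedding.
Local Opaque partial L2dot.
Variables (R : realType) (d : nat) (Omega : set 'rV[R]_d).
Hypotheses (hd : d = 2%N \/ d = 3%N) (oOmega : open Omega).
Implicit Types (f g phi : 'rV[R]_d -> R) (i : 'I_d).
Local Notation mu := (lebesgue_rV R d).

Let mOmega : measurable Omega. Proof. exact: open_rV_measurable. Qed.

Lemma test_fun_pow4 phi : test_fun Omega phi ->
  (\int[mu]_x (phi x ^+ 4)%:E <= (2 * (H1sqr Omega phi) ^+ 2)%:E)%E.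
Proof.
move: Omega oOmega phi; case: hd => -> O oO phi.
  exact: test_fun_pow4_2.
exact: test_fun_pow4_3.
Qed.

Lemma measurable_min_norm_pow4 f (k : nat) : measurable_fun Omega f ->
  measurable_fun Omega (fun x => (Num.min `|f x| k%:R ^+ 4)%:E).
Proof.
move=> mf; apply/measurable_EFinP; apply: measurable_funX; apply/measurable_EFinP.
rewrite (_ : _ \o _ = (fun x => mine (`|f x|%:E) (k%:R%:E))%E); last first.
  by apply/funext => x; rewrite /= EFin_min.
apply: measurable_mine; last exact: measurable_cst.
by apply/measurable_EFinP; exact: measurableT_comp.
Qed.

(* Uniform in [k]: [f] is approximated up to [1 / (k + 1)] so that the factor
   [8 k^2] of pow4_min_le is absorbed. *)
Lemma H10_min_pow4 f (k : nat) : H10space Omega f ->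
  (\int[mu]_(x in Omega) (Num.min `|f x| k%:R ^+ 4)%:E <=
   (8 + 4 * (2 + 2 * H1sqr Omega f) ^+ 2)%:E)%E.
Proof.
move=> hf; have k0 : 0 < (k.+1)%:R^-1 :> R by rewrite invr_gt0.
have [h [phi [tphi hh heps fE phiE]]] := H10_approx oOmega hf k0.
have [lf _] := hf.1; have mf := L2_measurable mOmega lf.
have [lh _] := hh; have mh := L2_measurable mOmega lh.
have Cphi := test_fun_Cc tphi.
have h0 : 0 <= H1sqr Omega h by apply: le_trans (L2dot_le_H1sqr Omega h); exact: L2dot_ge0.
have h1 : H1sqr Omega h <= 1.
  apply: le_trans (ltW heps) _.
  by rewrite expr_le1 ?invr_ge0// invf_le1// ler1n.
have kh : k%:R ^+ 2 * H1sqr Omega h <= 1.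
  apply: (@le_trans _ _ (k%:R ^+ 2 * (k.+1)%:R^-1 ^+ 2)).
    by rewrite ler_wpM2l ?sqr_ge0// ltW.
  rewrite -exprMn expr_le1 ?mulr_ge0 ?invr_ge0//.
  by rewrite ler_pdivrMr// mul1r ler_nat.
have Nphi : H1sqr Omega phi <= 2 + 2 * H1sqr Omega f.
  have := H1sqr_lin_le oOmega (-1) hh hf.1; rewrite -phiE sqrrN expr1n mulr1.
  move=> /le_trans; apply; rewrite lerD2r.
  by move: h1; move: (H1sqr Omega h) => x; lra.
have mp : measurable_fun Omega (fun x => phi x ^+ 4).
  by apply: measurable_funX; apply: measurable_funTS; exact: Cc_measurable.
apply: (@le_trans _ _ (\int[mu]_(x in Omega)
   ((8 * k%:R ^+ 2)%:E * (h x ^+ 2)%:E + 2%:E * (phi x ^+ 4)%:E))%E).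
  apply: ge0_le_integral => //.
  - exact: measurable_min_norm_pow4.
  - apply: emeasurable_funD; apply: measurable_funeM; apply/measurable_EFinP => //.
    exact: measurable_funX.
  move=> x _; rewrite -!EFinM -EFinD lee_fin.
  have -> : h x = f x - phi x by rewrite fE scale1r addrK.
  exact: pow4_min_le.
rewrite ge0_integralD//; last 4 first.
- by move=> x _; rewrite -EFinM lee_fin; apply: mulr_ge0; [apply: mulr_ge0|]; rewrite ?sqr_ge0.
- by apply: measurable_funeM; apply/measurable_EFinP; exact: measurable_funX.
- by move=> x _; rewrite -EFinM lee_fin mulr_ge0// (exprM _ 2 2) sqr_ge0.
- by apply: measurable_funeM; exact/measurable_EFinP.
rewrite ge0_integralZl//; last 2 first.
- by apply/measurable_EFinP; exact: measurable_funX.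
- by move=> x _; rewrite lee_fin sqr_ge0.
rewrite ge0_integralZl//; last 2 first.
- exact/measurable_EFinP.
- by move=> x _; rewrite lee_fin (exprM _ 2 2) sqr_ge0.
rewrite (L2_integral_sqr mOmega lh).
have p4 : (\int[mu]_(x in Omega) (phi x ^+ 4)%:E <=
    (2 * (2 + 2 * H1sqr Omega f) ^+ 2)%:E)%E.
  apply: le_trans (le_trans (test_fun_pow4 tphi) _).
    apply: ge0_subset_integral => //.
      by apply/measurable_EFinP; apply: measurable_funX; exact: Cc_measurable.
    by move=> x _; rewrite lee_fin (exprM _ 2 2) sqr_ge0.
  have p0 : 0 <= H1sqr Omega phi.
    by apply: le_trans (L2dot_le_H1sqr Omega phi); exact: L2dot_ge0.
  rewrite lee_fin ler_wpM2l// ler_sqr ?nnegrE//; exact: le_trans Nphi.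
apply: le_trans (leeD (le_refl _) (lee_wpmul2l _ p4)) _ => //.
rewrite -!EFinM -EFinD lee_fin.
by apply: truncation_bound kh; rewrite ler_wpM2l ?sqr_ge0// L2dot_le_H1sqr.
Qed.

(** At each point the truncations increase and are eventually equal to |f|; their fourth powers have
    uniformly bounded integrals, so monotone convergence applies. *)
Lemma H10_pow4_integrable f : H10space Omega f ->
  mu.-integrable Omega (EFin \o (fun x => f x ^+ 4)).
Proof.
move=> hf; have [lf _] := hf.1; have mf := L2_measurable mOmega lf.
have mf4 : measurable_fun Omega (EFin \o (fun x => f x ^+ 4)).
  by apply/measurable_EFinP; exact: measurable_funX.
apply/integrableP; split => //.
pose g (k : nat) x := (Num.min `|f x| k%:R ^+ 4)%:E.
have g0 k x : (0 <= g k x)%E by rewrite lee_fin exprn_ge0// le_min normr_ge0 ler0n.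
have ndg x : {homo g^~ x : m n / (m <= n)%N >-> (m <= n)%E}.
  move=> m n mn; rewrite lee_fin lerXn2r ?nnegrE ?le_min ?normr_ge0 ?ler0n//.
  by rewrite ge_min lexx/= ge_min ler_nat mn orbT.
have limg x : (g k x @[k --> \oo] --> `|(f x ^+ 4)%:E|)%E.
  apply: cvg_near_cst; near=> k.
  rewrite /g min_l; first by rewrite /= normrX.
  near: k; exact: nbhs_infty_ger.
have := @cvg_monotone_convergence _ _ _ mu Omega mOmega g
  (fun k => measurable_min_norm_pow4 k mf) (fun k x _ => g0 k x) (fun x _ => ndg x).
rewrite (_ : (\int[mu]_(x in Omega) limn (g^~ x))%E =
   (\int[mu]_(x in Omega) `|(f x ^+ 4)%:E|)%E); last first.
  by apply: eq_integral => x _; apply/cvg_lim.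
move=> h; apply: (@le_lt_trans _ _ (8 + 4 * (2 + 2 * H1sqr Omega f) ^+ 2)%:E);
  last exact: ltry.
rewrite -(cvg_lim _ h)//; apply: lime_le; first by apply/cvg_ex; eexists; exact: h.
by near=> k; exact: H10_min_pow4.
Unshelve. all: by end_near. Qed.

Lemma H10_mul_L2 f g : H10space Omega f -> H10space Omega g -> L2 Omega (f * g).
Proof.
move=> hf hg; have [lf _] := hf.1; have [lg _] := hg.1.
apply: (@L2_of_sqr_le _ _ _ mOmega _ (fun x => f x ^+ 4 + g x ^+ 4)).
- by apply: measurable_funM; exact: L2_measurable.
- have := integrableD mOmega (H10_pow4_integrable hf) (H10_pow4_integrable hg).
  by apply: eq_integrable.
- move=> x _; rewrite mulrfctE exprMn.
  have -> : f x ^+ 4 = (f x ^+ 2) ^+ 2 by rewrite -exprM.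
  have -> : g x ^+ 4 = (g x ^+ 2) ^+ 2 by rewrite -exprM.
  by have := sqr_ge0 (f x ^+ 2 - g x ^+ 2);
    have := sqr_ge0 (f x ^+ 2 + g x ^+ 2); nra.
Qed.

End H10_embedding.

Section poincare.
Local Opaque partial L2dot.
Variables (R : realType) (n : nat) (Omega : set 'rV[R]_n.+1).
Hypotheses (oOmega : open Omega) (bOmega : bounded_set Omega).

Let mOmega : measurable Omega. Proof. exact: open_rV_measurable. Qed.

Lemma bounded_cube : exists2 L : R, 0 < L & Omega `<=` cube L.
Proof.
have [M [_ OM]] := bOmega; exists (`|M| + 1); first by rewrite ltr_wpDl.
move=> x /OM xM i; have /xM : M < `|M| + 1 by rewrite ltr_pwDr// ler_norm.
apply: le_trans; rewrite [leRHS]/Num.norm/= mx_normrE.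
exact: (le_bigmax _ (fun ij : 'I_1 * 'I_n.+1 => `|x ij.1 ij.2|) (ord0, i)).
Qed.

Lemma poincare : exists2 C : R, 0 <= C & forall f, H10space Omega f ->
  L2dot Omega f f <= C * L2dot Omega (partial Omega (ord0S n) f) (partial Omega (ord0S n) f).
Proof.
have [L L0 OL] := bounded_cube.
have P phi : test_fun Omega phi -> L2dot Omega phi phi <= 16 * L ^+ 2 *
    L2dot Omega (partial Omega (ord0S n) phi) (partial Omega (ord0S n) phi).
  move=> tphi; rewrite test_fun_partialK//.
  have tp := test_fun_partial (ord0S n) tphi.
  have phi0 x : ~ cube L x -> phi x = 0.
    by move=> xL; apply: (test_fun_eq0 tphi); apply: contra_not xL; exact: OL.
  exact: (poincare_Cc (test_fun_Cc tphi) (test_fun_Cc tp) L0 phi0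
    (fun x => test_fun_is_derive (ord0S n) x tphi)
    (test_fun_integral_sqr tphi) (test_fun_integral_sqr tp)).
(* 64 = 16 * 2 * 2: one factor 2 for passing from [f] to [phi], one for passing back on the
   derivatives. *)
exists (64 * L ^+ 2) => [|f hf]; first by rewrite mulr_ge0// sqr_ge0.
have K0 : 0 < 2 + 64 * L ^+ 2 by rewrite ltr_wpDr// mulr_ge0// sqr_ge0.
apply/ler_addgt0Pr => e e0.
(* The tolerance is chosen so that the terms in [h], at most (2 + 64 L^2) times its squared H1 norm,
   stay below [e]. *)
have q0 : 0 < Num.sqrt (e / (2 + 64 * L ^+ 2)) by rewrite sqrtr_gt0 divr_gt0.
have [h [phi [tphi hh heps fE phiE]]] := H10_approx oOmega hf q0.
have hphi := test_fun_H1 oOmega tphi.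
have h2 : H1sqr Omega h * (2 + 64 * L ^+ 2) <= e.
  rewrite -ler_pdivlMr//; apply: ltW; move: heps; rewrite sqr_sqrtr//.
  by rewrite divr_ge0// ltW.
have I1 := L2dot_lin_le oOmega 1 hh.1 hphi.1.
have I2 := P _ tphi.
have I3 := L2dot_partial_lin_le oOmega (ord0S n) (-1) hh hf.1.
have I4 := L2dot_le_H1sqr Omega h.
have I5 := L2dot_partial_le_H1sqr Omega (ord0S n) h.
rewrite -fE in I1; rewrite -phiE in I3.
exact: approximation_bound (sqr_ge0 L) h2 I1 I2 I3 I4 I5.
Qed.

End poincare.

(** * The Galerkin system and the energy estimate *)

Section galerkin.
Variables (R : realType) (V : lmodType R) (eqV : V -> V -> Prop) (S : set V).
Hypothesis fS : fin_dim_subspace eqV S.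

Definition linear_on (g : V -> R) :=
  forall a u v, S u -> S v -> g (a *: u + v) = a * g u + g v.

Let S0 : S 0. Proof. by case: fS. Qed.
Let S_lin a u v : S u -> S v -> S (a *: u + v). Proof. by case: fS => _ h _; exact: h. Qed.

Lemma linear_on0 g : linear_on g -> g 0 = 0.
Proof.
move=> gl; have := gl 1 0 0 S0 S0; rewrite scaler0 addr0 mul1r => h.
by apply: (addrI (g 0)); rewrite addr0.
Qed.

Lemma subspace_sum n (c : 'I_n -> R) (b : 'I_n -> V) : (forall i, S (b i)) ->
  S (\sum_(i < n) c i *: b i).
Proof.
move=> Sb; elim/big_rec : _ => // i v _ Sv; exact: S_lin.
Qed.

Lemma linear_on_sum g n (c : 'I_n -> R) (b : 'I_n -> V) : linear_on g ->
  (forall i, S (b i)) -> g (\sum_(i < n) c i *: b i) = \sum_(i < n) c i * g (b i).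
Proof.
move=> gl Sb.
suff : S (\sum_(i < n) c i *: b i) /\
  g (\sum_(i < n) c i *: b i) = \sum_(i < n) c i * g (b i) by case.
elim/big_rec2 : _ => [|i x v _ [Sv gv]]; first by split; [exact: S0|exact: linear_on0].
by split; [exact: S_lin|rewrite gl// gv].
Qed.

(* The Gram matrix of a family that only spans S modulo eqV may be singular;
   its system is still solvable since its kernel consists of null vectors, on
   which the right-hand side vanishes. *)
Lemma galerkin (B : V -> V -> R) (l : V -> R) :
  (forall w, S w -> linear_on (B w)) -> (forall w, S w -> linear_on (B^~ w)) ->
  linear_on l ->
  (forall u v, S u -> S v -> eqV u v -> eqV (-1 *: v + u) 0) ->
  (forall v, S v -> eqV v 0 -> l v = 0 /\ forall w, S w -> B w v = 0) ->
  (forall v, S v -> B v v = 0 -> eqV v 0) ->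
  exists2 u, S u & forall v, S v -> B u v = l v.
Proof.
move=> Br Bl ll eqVB null coercive.
have [_ _ [n [b [Sb span]]]] := fS.
pose A : 'M[R]_n := \matrix_(i, j) B (b i) (b j).
pose F : 'rV[R]_n := \row_j l (b j).
(* Row-space membership is tested on the cokernel: a column e of it satisfies A e = 0, so the
   combination v of the [b j] with coefficients e has B v v = 0. Coercivity makes v null, hence
   [l v] = 0. *)
have /submxP[c Fc] : (F <= A)%MS.
  rewrite submxE; apply/eqP/rowP => k; rewrite !mxE.
  pose e j := cokermx A j k; pose v := \sum_(j < n) e j *: b j.
  have Sv : S v by exact: subspace_sum.
  have Ae i : \sum_(j < n) A i j * e j = 0.
    by have /matrixP/(_ i k) := mulmx_coker A; rewrite !mxE.
  have Bv i : B (b i) v = 0.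
    rewrite linear_on_sum//; last exact: Br.
    by rewrite -[RHS](Ae i); apply: eq_bigr => j _; rewrite mxE mulrC.
  have Bvv : B v v = 0.
    rewrite {1}/v (@linear_on_sum (B^~ v))//; last exact: Bl.
    by apply: big1 => i _; rewrite Bv mulr0.
  have [lv _] := null _ Sv (coercive _ Sv Bvv).
  rewrite -[RHS]lv linear_on_sum//.
  by apply: eq_bigr => j _; rewrite mxE mulrC.
exists (\sum_(i < n) c ord0 i *: b i); first exact: subspace_sum.
set u := \sum_(i < n) _; have Su : S u by exact: subspace_sum.
have ub j : B u (b j) = l (b j).
  have /rowP/(_ j) := Fc; rewrite !mxE => ->.
  rewrite (@linear_on_sum (B^~ (b j)))//; last exact: Bl.
  by apply: eq_bigr => i _; rewrite mxE.
(* [v] is only equivalent to a combination w of the family; their difference is null, so both sides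
   of the equation take the same value at v and at w. *)
move=> v Sv; have [e /eqVB] := span _ Sv.
set w := \sum_(i < n) _; have Sw : S w by exact: subspace_sum.
move=> /(_ Sv Sw) vw0; have [lz Bz] := null _ (S_lin (-1) Sw Sv) vw0.
have := Bz _ Su; rewrite (Br u Su) => //; rewrite mulN1r addrC => /eqP.
rewrite subr_eq0 => /eqP ->.
move: lz; rewrite ll// mulN1r addrC => /eqP; rewrite subr_eq0 => /eqP ->.
rewrite /w !linear_on_sum//; last exact: Br.
by apply: eq_bigr => i _; rewrite ub.
Qed.

End galerkin.

Section energy_algebra.
Variable R : rcfType.

(* [gUU], [guU], [guu], [PP], [Pp], [pp], [dd], [dP], [dp] are the inner products of
   gradients, pressures, and [div U] with itself, [P] and [p]; [s] is [|grad U|] and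
   [N] is [|f|_{-1}]. *)
Lemma energy_bound (nu rho alpha gUU guU guu PP Pp pp dd dP dp FU s N : R) :
  0 < nu -> 0 < rho -> 0 < alpha -> 0 <= s -> s ^+ 2 = gUU ->
  0 <= gUU - 2 * guU + guu -> 0 <= PP - 2 * Pp + pp ->
  0 <= (rho / alpha) ^+ 2 * dd + 2 * (rho / alpha) * (dP - dp) + (PP - 2 * Pp + pp) ->
  rho^-1 * (gUU - guU) + nu * gUU + rho / alpha * dd - dp = FU ->
  alpha * (PP - Pp) + rho * dP = 0 -> alpha * (Pp - pp) + rho * dp = 0 ->
  FU <= N * s ->
  gUU + alpha * PP <= guu + alpha * pp + rho / nu * N ^+ 2.
Proof.
move=> nu0 rho0 al0 s0 sg hU hP0 hP e1 e2 e3 FN.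
have E1 : gUU - guU + rho * nu * gUU + rho ^+ 2 / alpha * dd - rho * dp = rho * FU.
  by rewrite -e1; field; rewrite !gt_eqF.
(* The mass equation tested with P and with p gives (rho / alpha) (div U, P - p) = -|P - p|^2.
   Inserting this in the square of (rho / alpha) div U + (P - p) leaves |P - p| <= (rho / alpha)
   |div U|. *)
have X : alpha * (PP - 2 * Pp + pp) <= rho ^+ 2 / alpha * dd.
  have -> : rho ^+ 2 / alpha * dd = alpha * ((rho / alpha) ^+ 2 * dd) by field; rewrite gt_eqF.
  rewrite ler_pM2l//.
  have : rho / alpha * (dP - dp) = - (PP - 2 * Pp + pp).
    apply: (mulfI (lt0r_neq0 al0)).
    have -> : alpha * (rho / alpha * (dP - dp)) = rho * dP - rho * dp by field; rewrite gt_eqF.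
    lra.
  lra.
have F2 : rho * FU <= rho * (N * s) by rewrite ler_pM2l.
(* Young's inequality spends exactly the viscous term. After the doubling due to polarization, rho /
   (2 nu) N^2 remains, which is within the claimed bound. *)
have : rho * (N * s) <= rho * nu * gUU + rho / nu * N ^+ 2 / 4.
  have -> : rho * (N * s) = rho * nu * gUU + rho / nu * N ^+ 2 / 4 -
      rho * nu * (s - N / (2 * nu)) ^+ 2 by rewrite -sg; field; rewrite gt_eqF.
  by rewrite lerBlDr lerDl mulr_ge0 ?sqr_ge0// mulr_ge0// ltW.
have : 0 <= rho / nu * N ^+ 2 by rewrite mulr_ge0 ?sqr_ge0// divr_ge0// ltW.
have : 0 <= alpha * (PP - 2 * Pp + pp) by rewrite mulr_ge0// ltW.
lra.
Qed.

Lemma sqrt_energy_bound (x y c N : R) : 0 <= y -> 0 <= c -> 0 <= N ->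
  x <= y + c * N ^+ 2 -> Num.sqrt x <= Num.sqrt y + Num.sqrt c * N.
Proof.
move=> y0 c0 N0 xy.
have h0 : 0 <= Num.sqrt y + Num.sqrt c * N by rewrite addr_ge0 ?mulr_ge0 ?sqrtr_ge0.
rewrite -(ger0_norm h0) -sqrtr_sqr ler_sqrt ?sqr_ge0//; apply: le_trans xy _.
rewrite sqrrD exprMn !sqr_sqrtr// -addrA addrCA lerDr.
by rewrite mulrn_wge0// mulr_ge0 ?mulr_ge0 ?sqrtr_ge0.
Qed.

End energy_algebra.

(** * The forms of the scheme *)

Section vector_forms.
Variables (R : realType) (d : nat) (Omega : set 'rV[R]_d).
Hypotheses (hd : d = 2%N \/ d = 3%N) (oOmega : open Omega) (bOmega : bounded_set Omega).
Implicit Types (f g : scalar_field R d) (u v w : vector_field R d).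
Local Notation X := (Xspace Omega).
Local Notation mu := (lebesgue_rV R d).

Let mOmega : measurable Omega. Proof. exact: open_rV_measurable. Qed.

Lemma Rintegral_sum (F : 'I_d -> scalar_field R d) :
  (forall j, mu.-integrable Omega (EFin \o F j)) ->
  Rintegral mu Omega (fun x => \sum_(j < d) F j x) = \sum_(j < d) Rintegral mu Omega (F j).
Proof.
move=> iF.
suff H (r : seq 'I_d) : mu.-integrable Omega (EFin \o (fun x => \sum_(j <- r) F j x)) /\
    Rintegral mu Omega (fun x => \sum_(j <- r) F j x) = \sum_(j <- r) Rintegral mu Omega (F j).
  by have [] := H (index_enum 'I_d).
elim: r => [|j r [ir Er]].
  have E : (fun x : 'rV[R]_d => \sum_(j <- [::]) F j x) = cst 0.
    by apply/funext => x; rewrite big_nil.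
  rewrite E big_nil; split; first exact: integrable0.
  by rewrite /Rintegral integral0.
have E : (fun x => \sum_(j <- j :: r) F j x) = (fun x => F j x + \sum_(j <- r) F j x).
  by apply/funext => x; rewrite big_cons.
rewrite E big_cons RintegralD// Er; split => //.
exact: (integrableD mOmega (iF j) ir).
Qed.

Lemma Xspace_H1 v i : X v -> H1space Omega (v i).
Proof. by move=> Xv; case: (Xv i). Qed.

Lemma Xspace_L2 v i : X v -> L2 Omega (v i).
Proof. by move=> Xv; case: (Xspace_H1 i Xv). Qed.

Lemma Xspace_L2_partial v i j : X v -> L2 Omega (partial Omega j (v i)).
Proof. by move=> Xv; apply: L2_partial; exact: Xspace_H1. Qed.

Lemma Xspace_mul_L2 u w i j : X u -> X w -> L2 Omega (u j * w i).
Proof. by move=> Xu Xw; exact: (H10_mul_L2 hd oOmega). Qed.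

Lemma divergenceE v : divergence Omega v = \sum_(i < d) partial Omega i (v i).
Proof. by apply/funext => x; rewrite /divergence fct_sumE. Qed.

Lemma L2_divergence v : X v -> L2 Omega (divergence Omega v).
Proof.
by move=> Xv; rewrite divergenceE; apply: L2_sum => // i _; exact: Xspace_L2_partial.
Qed.

(** The factors are regrouped as a gradient entry times [u j * w i], both in L2, so that the L2
    calculus applies to each term of the sum. *)
Lemma convect_dotE u v w : X u -> X v -> X w ->
  vdot Omega (convect Omega u v) w =
  \sum_(i < d) \sum_(j < d) L2dot Omega (partial Omega j (v i)) (u j * w i).
Proof.
move=> Xu Xv Xw; apply: eq_bigr => i _.
rewrite /L2dot -Rintegral_sum => [|j]; last first.
  exact: L2_mul_integrable (Xspace_L2_partial i j Xv) (Xspace_mul_L2 i j Xu Xw).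
apply: eq_Rintegral => x _; rewrite /convect mulr_suml.
by apply: eq_bigr => j _; rewrite mulrfctE mulrA [_ * u j x]mulrC.
Qed.

Local Opaque partial L2dot.

Lemma L2dot_partial_linl i j a u v g : X u -> X v -> L2 Omega g ->
  L2dot Omega (partial Omega j ((a *: u + v) i)) g =
  a * L2dot Omega (partial Omega j (u i)) g + L2dot Omega (partial Omega j (v i)) g.
Proof.
move=> Xu Xv lg; have hu := Xspace_H1 i Xu; have hv := Xspace_H1 i Xv.
have lu := L2_partial j hu; have lv := L2_partial j hv.
rewrite -L2dot_linl//; apply: L2dot_ae => //.
- exact: L2_partial (H1_lin oOmega a hu hv).
- exact: L2_lin.
- exact: partial_lin.
Qed.

Lemma grad_dotC u v : grad_dot Omega u v = grad_dot Omega v u.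
Proof. by apply: eq_bigr => i _; apply: eq_bigr => j _; rewrite L2dotC. Qed.

Lemma grad_dot_linl a u v w : X u -> X v -> X w ->
  grad_dot Omega (a *: u + v) w = a * grad_dot Omega u w + grad_dot Omega v w.
Proof.
move=> Xu Xv Xw; rewrite /grad_dot mulr_sumr -big_split/=; apply: eq_bigr => i _.
rewrite mulr_sumr -big_split/=; apply: eq_bigr => j _.
by apply: L2dot_partial_linl => //; exact: Xspace_L2_partial.
Qed.

Lemma grad_dot_linr a u v w : X u -> X v -> X w ->
  grad_dot Omega w (a *: u + v) = a * grad_dot Omega w u + grad_dot Omega w v.
Proof. by move=> *; rewrite !(grad_dotC w) grad_dot_linl. Qed.

Lemma grad_dot_ge0 u : 0 <= grad_dot Omega u u.
Proof. by apply: sumr_ge0 => i _; apply: sumr_ge0 => j _; exact: L2dot_ge0. Qed.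

Lemma L2dot_div_linl a u v g : X u -> X v -> X (a *: u + v) -> L2 Omega g ->
  L2dot Omega (divergence Omega (a *: u + v)) g =
  a * L2dot Omega (divergence Omega u) g + L2dot Omega (divergence Omega v) g.
Proof.
have D w : X w -> L2 Omega g -> L2dot Omega (divergence Omega w) g =
    \sum_(i < d) L2dot Omega (partial Omega i (w i)) g.
  move=> Xw lg; rewrite divergenceE.
  pose F i := partial Omega i (w i).
  have lF i : L2 Omega (F i) by exact: Xspace_L2_partial.
  suff H (r : seq 'I_d) : L2dot Omega (\sum_(i <- r) F i) g = \sum_(i <- r) L2dot Omega (F i) g.
    exact: (H (index_enum 'I_d)).
  elim: r => [|i r IH].
    rewrite !big_nil; apply: (addrI (L2dot Omega 0 g)); rewrite addr0.
    have := L2dot_linl mOmega 1 (L2_0 mOmega) (L2_0 mOmega) lg.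
    by rewrite scaler0 addr0 mul1r.
  rewrite !big_cons -IH -[F i in LHS]scale1r L2dot_linl ?mul1r//.
  by apply: L2_sum => // k _.
move=> Xu Xv Xuv lg; rewrite !D// mulr_sumr -big_split/=; apply: eq_bigr => i _.
exact: L2dot_partial_linl.
Qed.

(* The products [u j * w i] are in [L2] by the [L4] embedding, so all these
   integrals converge. *)
Lemma bstarE u v w : X u -> X v -> X w -> bstar Omega u v w =
  2^-1 * (\sum_(i < d) \sum_(j < d) L2dot Omega (partial Omega j (v i)) (u j * w i)) -
  2^-1 * (\sum_(i < d) \sum_(j < d) L2dot Omega (partial Omega j (w i)) (u j * v i)).
Proof. by move=> Xu Xv Xw; rewrite /bstar !convect_dotE. Qed.

Lemma bstar_skew u v : bstar Omega u v v = 0.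
Proof. by rewrite /bstar subrr. Qed.

Lemma bstarN u v w : bstar Omega u v w = - bstar Omega u w v.
Proof. by rewrite /bstar opprB. Qed.

Lemma bstar_linr a u v w w' : X u -> X v -> X w -> X w' -> X (a *: w + w') ->
  bstar Omega u v (a *: w + w') = a * bstar Omega u v w + bstar Omega u v w'.
Proof.
move=> Xu Xv Xw Xw' Xl; rewrite !bstarE//.
pose A w := \sum_(i < d) \sum_(j < d) L2dot Omega (partial Omega j (v i)) (u j * w i).
pose B w := \sum_(i < d) \sum_(j < d) L2dot Omega (partial Omega j (w i)) (u j * v i).
have HA : A (a *: w + w') = a * A w + A w'.
  rewrite /A mulr_sumr -big_split/=; apply: eq_bigr => i _.
  rewrite mulr_sumr -big_split/=; apply: eq_bigr => j _.
  rewrite -L2dot_linr//; [|exact: Xspace_mul_L2|exact: Xspace_mul_L2|exact: Xspace_L2_partial].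
  congr L2dot; apply/funext => x.
  by rewrite (_ : (u j * (a *: w + w') i) x = u j x * (a * w i x + w' i x))//
    (_ : (a *: (u j * w i) + u j * w' i) x = a * (u j x * w i x) + u j x * w' i x)//; ring.
have HB : B (a *: w + w') = a * B w + B w'.
  rewrite /B mulr_sumr -big_split/=; apply: eq_bigr => i _.
  rewrite mulr_sumr -big_split/=; apply: eq_bigr => j _.
  by apply: L2dot_partial_linl => //; exact: Xspace_mul_L2.
have key (c x x' y y' : R) :
    c * (a * x + x') - c * (a * y + y') = a * (c * x - c * y) + (c * x' - c * y').
  by ring.
exact: etrans (congr2 (fun x y => 2^-1 * x - 2^-1 * y) HA HB) (key _ _ _ _ _).
Qed.

(** Skew-symmetry transports linearity from the last argument. *)
Lemma bstar_linm a u v w w' : X u -> X v -> X w -> X w' -> X (a *: w + w') ->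
  bstar Omega u (a *: w + w') v = a * bstar Omega u w v + bstar Omega u w' v.
Proof.
move=> Xu Xv Xw Xw' Xl; rewrite bstarN bstar_linr// (bstarN u w) (bstarN u w').
by rewrite opprD mulrN.
Qed.

Lemma L2dot_null f g : L2 Omega f -> L2 Omega g -> ae_eqs Omega g 0 -> L2dot Omega f g = 0.
Proof.
move=> lf lg g0; rewrite L2dotC (L2dot_ae mOmega lg (L2_0 mOmega) lf g0).
apply: (addrI (L2dot Omega 0 f)); rewrite addr0.
have := L2dot_linl mOmega 1 (L2_0 mOmega) (L2_0 mOmega) lf.
by rewrite scaler0 addr0 mul1r.
Qed.

(** The zero function is a weak derivative of a null function, and weak derivatives are unique a.e.
    Through this the forms vanish on null fields. *)
Lemma partial_null i f : H1space Omega f -> ae_eqs Omega f 0 ->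
  ae_eqs Omega (partial Omega i f) 0.
Proof.
move=> hf f0; apply: (partial_unique oOmega hf (L2_0 mOmega)) => phi tphi.
have lphi := test_fun_L2 oOmega tphi.
have ldphi := test_fun_L2 oOmega (test_fun_partial i tphi).
rewrite L2dotC L2dot_null//; last by case: hf.
rewrite L2dotC L2dot_null ?oppr0//; [exact: L2_0|exact: ae_eqs_refl].
Qed.

Lemma divergence_null v : X v -> ae_eqv Omega v 0 -> ae_eqs Omega (divergence Omega v) 0.
Proof.
move=> Xv v0; rewrite divergenceE.
suff H (r : seq 'I_d) : ae_eqs Omega (\sum_(i <- r) partial Omega i (v i)) 0.
  exact: (H (index_enum 'I_d)).
elim: r => [|i r IH]; first by rewrite big_nil; exact: ae_eqs_refl.
rewrite big_cons -[X in ae_eqs _ (X + _) _]scale1r -[X in ae_eqs _ _ X]addr0.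
rewrite -[X in ae_eqs _ _ (X + _)](scaler0 _ 1).
apply: ae_eqs_lin => //; apply: partial_null; [exact: Xspace_H1|exact: v0].
Qed.

Lemma grad_dot_null u v : X u -> X v -> ae_eqv Omega v 0 -> grad_dot Omega u v = 0.
Proof.
move=> Xu Xv v0; apply: big1 => i _; apply: big1 => j _.
apply: L2dot_null; [exact: Xspace_L2_partial|exact: Xspace_L2_partial|].
by apply: partial_null; [exact: Xspace_H1|exact: v0].
Qed.

Lemma bstar_null u v w : X u -> X v -> X w -> ae_eqv Omega w 0 -> bstar Omega u v w = 0.
Proof.
move=> Xu Xv Xw w0; rewrite bstarE// !big1 ?mulr0 ?subrr// => i _; apply: big1 => j _.
  rewrite L2dotC L2dot_null//; [exact: Xspace_mul_L2|exact: Xspace_L2_partial|].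
  by apply: partial_null; [exact: Xspace_H1|exact: w0].
apply: L2dot_null; [exact: Xspace_L2_partial|exact: Xspace_mul_L2|].
have := w0 i; rewrite /ae_eqs /ae_eq; apply: filterS => x h Ox.
by rewrite mulrfctE h// mulr0.
Qed.

(** Poincare's inequality componentwise; a single direction of differentiation already controls the
    L2 part. It makes the gradient form definite modulo null fields and functionals bounded in the
    gradient norm. *)
Lemma H1sqr_le_grad : exists2 K, 0 <= K & forall v, X v ->
  \sum_(i < d) H1sqr Omega (v i) <= K * grad_dot Omega v v.
Proof.
have [C C0 [k HC]] : exists2 C : R, 0 <= C & exists k : 'I_d, forall f, H10space Omega f ->
    L2dot Omega f f <= C * L2dot Omega (partial Omega k f) (partial Omega k f).
  have d0 : (0 < d)%N by case: hd => ->.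
  move: oOmega bOmega; case: d d0 Omega => // n _ O oO bO.
  by have [C C0 HC] := poincare oO bO; exists C => //; exists (ord0S n).
exists (C + 1) => [|v Xv]; first by rewrite addr_ge0.
rewrite /grad_dot mulr_sumr; apply: ler_sum => i _.
rewrite mulrDl mul1r lerD2r; apply: le_trans (HC _ (Xv i)) _.
rewrite ler_wpM2l// (bigD1 k)//= lerDl sumr_ge0// => j _; exact: L2dot_ge0.
Qed.

Lemma grad_dot_eq0 v : X v -> grad_dot Omega v v = 0 -> ae_eqv Omega v 0.
Proof.
move=> Xv gv i; apply: (L2dot_eq0 mOmega); first exact: Xspace_L2.
have [K K0 /(_ v Xv)] := H1sqr_le_grad; rewrite gv mulr0 => S0.
apply/eqP; rewrite eq_le L2dot_ge0 andbT; apply: le_trans S0.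
apply: le_trans (L2dot_le_H1sqr Omega (v i)) _.
rewrite (bigD1 i)//= lerDl sumr_ge0// => j _.
by apply: le_trans (L2dot_le_H1sqr Omega (v j)); exact: L2dot_ge0.
Qed.

Lemma in_dual_grad_bound F : in_dual Omega F ->
  exists2 K, 0 <= K & forall v, X v -> `|F v| <= K * grad_norm Omega v.
Proof.
move=> [_ [C FC]]; have [K K0 HK] := H1sqr_le_grad.
exists (`|C| * Num.sqrt K) => [|v Xv]; first by rewrite mulr_ge0 ?sqrtr_ge0.
apply: le_trans (FC _ Xv) _.
(* [C] may be negative, so it is replaced by its absolute value. *)
apply: (@le_trans _ _ (`|C| * Xnorm Omega v)).
  by rewrite ler_wpM2r ?sqrtr_ge0// ler_norm.
rewrite -mulrA ler_wpM2l// -sqrtrM// ler_wsqrtr//.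
by under eq_bigr do rewrite H1normK; exact: HK.
Qed.

Lemma in_dual_null F v : in_dual Omega F -> X v -> ae_eqv Omega v 0 -> F v = 0.
Proof.
move=> /in_dual_grad_bound[K K0 FK] Xv v0; apply/eqP; rewrite -normr_le0.
by apply: le_trans (FK _ Xv) _; rewrite /grad_norm grad_dot_null// sqrtr0 mulr0.
Qed.

Lemma dual_norm_ge0 F : 0 <= dual_norm Omega F.
Proof.
rewrite /dual_norm; set S := [set _ | _ in _].
(* If the set is empty or unbounded, [sup] takes the value 0. *)
have [[[x Sx] ub]|/sup_out ->//] := pselect (has_sup S).
apply: le_trans (ub_le_sup ub Sx).
by case: Sx => v _ <-; rewrite divr_ge0 ?sqrtr_ge0.
Qed.

Lemma le_dual_norm F v : in_dual Omega F -> X v ->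
  F v <= dual_norm Omega F * grad_norm Omega v.
Proof.
(* The supremum leaves out null fields, but [F] vanishes on them. *)
move=> dF Xv; have [v0|v0] := pselect (ae_eqv Omega v 0).
  by rewrite (in_dual_null dF)// mulr_ge0 ?dual_norm_ge0 ?sqrtr_ge0.
have g0 : 0 < grad_norm Omega v.
  rewrite sqrtr_gt0 lt_neqAle grad_dot_ge0 andbT eq_sym; apply/eqP => gv.
  exact/v0/grad_dot_eq0.
rewrite -ler_pdivrMr//; apply: (@le_trans _ _ (`|F v| / grad_norm Omega v)).
  by rewrite ler_wpM2r ?invr_ge0 ?sqrtr_ge0// ler_norm.
have [K K0 FK] := in_dual_grad_bound dF.
apply: ub_le_sup; last by exists v.
exists K => _ [w [Xw w0] <-].
have gw : 0 < grad_norm Omega w.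
  rewrite sqrtr_gt0 lt_neqAle grad_dot_ge0 andbT eq_sym; apply/eqP => gw.
  exact/w0/grad_dot_eq0.
by rewrite ler_pdivrMr//; exact: FK.
Qed.

End vector_forms.

(** * One step of the scheme: existence, uniqueness and bound *)

Section step_algebra.
Variable R : realFieldType.

Lemma momentum_rearrange (r nu g1 g2 b k q F : R) :
  r * (g1 - g2) + nu * g1 + b + k - q = F <-> (r + nu) * g1 + b + k = F + r * g2 + q.
Proof. by split => ?; lra. Qed.

Lemma mass_rearrange (alpha rho P p q : R) :
  alpha * (P - p) + rho * q = 0 <-> alpha * P = alpha * p - rho * q.
Proof. by split => ?; lra. Qed.

Lemma coercive_eq0 (c g k z : R) : 0 < c -> 0 <= k -> 0 <= g -> 0 <= z ->
  c * g + 0 + k * z = 0 -> g = 0.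
Proof.
move=> c0 k0 g0 z0; rewrite addr0 => /eqP.
by rewrite paddr_eq0 ?mulr_ge0 ?(ltW c0)// mulf_eq0 gt_eqF//= => /andP[/eqP].
Qed.

Lemma lin_comb3 (a c r x y z x' y' z' : R) :
  c * (a * x + x') + (a * y + y') + r * (a * z + z') =
  a * (c * x + y + r * z) + (c * x' + y' + r * z').
Proof. ring. Qed.

Lemma lin_comb2 (a c r x y x' y' : R) :
  c * (a * x + x') - r * (a * y + y') = a * (c * x - r * y) + (c * x' - r * y').
Proof. ring. Qed.

Lemma lin_comb3' (a r x y z x' y' z' : R) :
  (a * x + x') + r * (a * y + y') + (a * z + z') =
  a * (x + r * y + z) + (x' + r * y' + z').
Proof. ring. Qed.

Lemma sub_sub_double (x y z : R) : x - y - (y - z) = x - 2 * y + z.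
Proof. ring. Qed.

Lemma sqr_neg_one_comb (x y z : R) : (-1) ^+ 2 * x + 2 * (-1) * y + z = z - 2 * y + x.
Proof. ring. Qed.

End step_algebra.

Section step.
Variables (R : realType) (d : nat) (Omega : set 'rV[R]_d).
Hypotheses (hd : d = 2%N \/ d = 3%N) (oOmega : open Omega) (bOmega : bounded_set Omega).
Variables (Xh : set (vector_field R d)) (Qh : set (scalar_field R d)).
Hypotheses (hXh : fin_dim_subspace (ae_eqv Omega) Xh) (hXhX : Xh `<=` Xspace Omega).
Hypotheses (hQh : fin_dim_subspace (ae_eqs Omega) Qh) (hQhQ : Qh `<=` L20 Omega).
Variables (F : vector_field R d -> R) (hF : in_dual Omega F).
Variables (nu rho alpha : R).
Hypotheses (hnu : 0 < nu) (hrho : 0 < rho) (halpha : 0 < alpha).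
Variables (uh : vector_field R d) (ph : scalar_field R d).
Hypotheses (huh : Xh uh) (hph : Qh ph).
Implicit Types (u v w : vector_field R d) (p q : scalar_field R d).
Local Notation is_step := (is_G Omega Xh Qh F nu rho alpha uh ph).
Local Notation div := (divergence Omega).

Let mOmega : measurable Omega. Proof. exact: open_rV_measurable. Qed.

Let Xh_lin a u v : Xh u -> Xh v -> Xh (a *: u + v).
Proof. by case: hXh => _ h _; exact: h. Qed.

Let Qh_lin a p q : Qh p -> Qh q -> Qh (a *: p + q).
Proof. by case: hQh => _ h _; exact: h. Qed.

Let Qh_L2 q : Qh q -> L2 Omega q. Proof. by move=> /hQhQ[]. Qed.

Let div_L2 v : Xh v -> L2 Omega (div v). Proof. by move=> /hXhX; exact: L2_divergence. Qed.

Local Opaque partial L2dot grad_dot bstar divergence.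

(** The part of the momentum equation that contains the unknown. The convecting field is frozen at
    [uh], which is what makes it bilinear; the old gradient and pressure go to [momentum_rhs]. *)
Definition momentum_form u v : R :=
  (rho^-1 + nu) * grad_dot Omega u v + bstar Omega uh u v +
  rho / alpha * L2dot Omega (div u) (div v).

Definition momentum_rhs v : R :=
  F v + rho^-1 * grad_dot Omega uh v + L2dot Omega ph (div v).

Lemma subr_scaleN1 (V : lmodType R) (x y : V) : x - y = -1 *: y + x.
Proof. by rewrite scaleN1r addrC. Qed.

Lemma L2dot_subl p q f : L2 Omega p -> L2 Omega q -> L2 Omega f ->
  L2dot Omega (p - q) f = L2dot Omega p f - L2dot Omega q f.
Proof. by move=> lp lq lf; rewrite subr_scaleN1 L2dot_linl// mulN1r addrC. Qed.

(** The system is triangular: the momentum equation contains only the old pressure, so [U] can be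
    found first and [P] from [U]. *)
Lemma is_stepP U P : is_step U P <-> [/\ Xh U, Qh P,
  forall v, Xh v -> momentum_form U v = momentum_rhs v &
  forall q, Qh q -> alpha * L2dot Omega P q =
    alpha * L2dot Omega ph q - rho * L2dot Omega (div U) q].
Proof.
have grad_sub v : Xh U -> Xh v ->
    grad_dot Omega (U - uh) v = grad_dot Omega U v - grad_dot Omega uh v.
  by move=> hU hv; rewrite subr_scaleN1 grad_dot_linl ?mulN1r 1?addrC//; exact: hXhX.
have X0 : Xh 0 by case: hXh.
have Q0 : Qh 0 by case: hQh.
split=> -[hU hP]; [move=> H; split=> // [v hv|q hq]|move=> H1 H2; split=> // v q hv hq; split].
(* Testing with zero in the other slot decouples the two equations. *)
- by have [+ _] := H v 0 hv Q0; rewrite grad_sub// => /momentum_rearrange.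
- have [_] := H 0 q X0 hq.
  by rewrite L2dot_subl => [/mass_rearrange|||]; rewrite ?mulrBr; first exact; exact: Qh_L2.
- by rewrite grad_sub//; apply/momentum_rearrange; exact: H1.
- by rewrite L2dot_subl; [apply/mass_rearrange; exact: H2|exact: Qh_L2..].
Qed.

Let XhX v : Xh v -> Xspace Omega v. Proof. exact: hXhX. Qed.

Lemma momentum_form_linr w : Xh w -> linear_on Xh (momentum_form w).
Proof.
move=> hw a u v hu hv; rewrite /momentum_form.
rewrite grad_dot_linr; [|exact: oOmega|exact: XhX..].
rewrite bstar_linr; [|exact: hd|exact: oOmega|exact: XhX|exact: XhX|exact: XhX|exact: XhX|].
  rewrite !(L2dotC _ (div w)) L2dot_div_linl; [|exact: oOmega|exact: XhX|exact: XhX| |exact: div_L2].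
    exact: lin_comb3.
  by apply: XhX; exact: Xh_lin.
by apply: XhX; exact: Xh_lin.
Qed.

Lemma momentum_form_linl w : Xh w -> linear_on Xh (momentum_form^~ w).
Proof.
move=> hw a u v hu hv; rewrite /momentum_form.
rewrite grad_dot_linl; [|exact: oOmega|exact: XhX..].
rewrite bstar_linm; [|exact: hd|exact: oOmega|exact: XhX|exact: XhX|exact: XhX|exact: XhX|].
  rewrite L2dot_div_linl; [|exact: oOmega|exact: XhX|exact: XhX| |exact: div_L2].
    exact: lin_comb3.
  by apply: XhX; exact: Xh_lin.
by apply: XhX; exact: Xh_lin.
Qed.

Lemma momentum_rhs_lin : linear_on Xh momentum_rhs.
Proof.
move=> a u v hu hv; rewrite /momentum_rhs.
rewrite grad_dot_linr; [|exact: oOmega|exact: XhX..].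
rewrite !(L2dotC _ ph) L2dot_div_linl; [|exact: oOmega|exact: XhX|exact: XhX| |exact: Qh_L2].
  have [Fl _] := hF; rewrite (Fl a u v (XhX hu) (XhX hv)).
  exact: lin_comb3'.
by apply: XhX; exact: Xh_lin.
Qed.

Lemma momentum_null v : Xh v -> ae_eqv Omega v 0 ->
  momentum_rhs v = 0 /\ forall w, Xh w -> momentum_form w v = 0.
Proof.
move=> hv v0; have Xv := XhX hv; have d0 := divergence_null oOmega Xv v0.
have g0 w : Xh w -> grad_dot Omega w v = 0.
  by move=> hw; exact: (grad_dot_null oOmega (XhX hw) Xv v0).
split=> [|w hw].
  rewrite /momentum_rhs (in_dual_null hd oOmega bOmega hF Xv v0) (g0 _ huh).
  by rewrite (L2dot_null oOmega (Qh_L2 hph) (div_L2 hv) d0) mulr0 !addr0.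
rewrite /momentum_form (g0 _ hw) (bstar_null hd oOmega (XhX huh) (XhX hw) Xv v0).
by rewrite (L2dot_null oOmega (div_L2 hw) (div_L2 hv) d0) !mulr0 !addr0.
Qed.

Lemma momentum_coercive v : Xh v -> momentum_form v v = 0 -> ae_eqv Omega v 0.
Proof.
move=> hv; rewrite /momentum_form bstar_skew => h.
apply: (grad_dot_eq0 hd oOmega bOmega); first exact: XhX.
apply: coercive_eq0 h.
- by rewrite addr_gt0 ?invr_gt0.
- by rewrite divr_ge0 ?ltW.
- exact: grad_dot_ge0.
- exact: L2dot_ge0.
Qed.

Lemma ae_eqs_sub0 p q : ae_eqs Omega p q <-> ae_eqs Omega (-1 *: q + p) 0.
Proof.
split; rewrite /ae_eqs /ae_eq; apply: filterS => x h Ox; have := h Ox;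
  rewrite (_ : (-1 *: q + p) x = -1 * q x + p x)// mulN1r addrC.
  by move=> ->; rewrite subrr.
by move/eqP; rewrite subr_eq0 => /eqP.
Qed.

Lemma ae_eqv_sub0 u v : ae_eqv Omega u v <-> ae_eqv Omega (-1 *: v + u) 0.
Proof. by split=> h i; [apply/(ae_eqs_sub0 (u i) (v i)).1|apply/ae_eqs_sub0]; exact: h. Qed.

Lemma step_exists : exists U P, is_step U P.
Proof.
have [U hU HU] := galerkin hXh momentum_form_linr momentum_form_linl momentum_rhs_lin
  (fun u v _ _ => (ae_eqv_sub0 u v).1) momentum_null momentum_coercive.
(* The pressure is found by the same lemma, as [Qh] too is spanned only modulo null sets. *)
pose B p q := alpha * L2dot Omega p q.
pose l q := alpha * L2dot Omega ph q - rho * L2dot Omega (div U) q.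
have Br s : Qh s -> linear_on Qh (B s).
  move=> hw a p q hp hq; rewrite /B L2dot_linr; [|exact: mOmega|exact: Qh_L2..].
  by rewrite mulrDr mulrCA.
have Bl s : Qh s -> linear_on Qh (B^~ s).
  move=> hw a p q hp hq; rewrite /B L2dot_linl; [|exact: mOmega|exact: Qh_L2..].
  by rewrite mulrDr mulrCA.
have ll : linear_on Qh l.
  move=> a p q hp hq; rewrite /l.
  rewrite (L2dot_linr mOmega a (Qh_L2 hp) (Qh_L2 hq) (Qh_L2 hph)).
  rewrite (L2dot_linr mOmega a (Qh_L2 hp) (Qh_L2 hq) (div_L2 hU)).
  exact: lin_comb2.
have null q : Qh q -> ae_eqs Omega q 0 -> l q = 0 /\ forall s, Qh s -> B s q = 0.
  move=> hq q0; split=> [|w hw]; rewrite /l /B.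
    rewrite (L2dot_null oOmega (Qh_L2 hph) (Qh_L2 hq) q0).
    by rewrite (L2dot_null oOmega (div_L2 hU) (Qh_L2 hq) q0) !mulr0 subrr.
  by rewrite (L2dot_null oOmega (Qh_L2 hw) (Qh_L2 hq) q0) mulr0.
have coer q : Qh q -> B q q = 0 -> ae_eqs Omega q 0.
  move=> hq /eqP; rewrite mulf_eq0 gt_eqF//= => /eqP.
  exact: L2dot_eq0 mOmega _ (Qh_L2 hq).
have [P hP HP] := galerkin hQh Br Bl ll (fun p q _ _ => (ae_eqs_sub0 p q).1) null coer.
by exists U, P; apply/is_stepP.
Qed.

Lemma step_unique U P U' P' : is_step U P -> is_step U' P' ->
  ae_eqv Omega U' U /\ ae_eqs Omega P' P.
Proof.
move=> /is_stepP[hU hP mU mP] /is_stepP[hU' hP' mU' mP'].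
have UU : ae_eqv Omega U' U.
  apply/ae_eqv_sub0; have hD := Xh_lin (-1) hU hU'.
  apply: momentum_coercive => //.
  rewrite (momentum_form_linl hD (-1) hU hU') mU// mU'//.
  by rewrite mulN1r addNr.
split=> //; apply/ae_eqs_sub0; have hD := Qh_lin (-1) hP hP'.
apply: (L2dot_eq0 mOmega); first exact: Qh_L2.
set D := -1 *: P + P' in hD *.
(* [U] and [U'] agree only a.e., so the divergence of their difference is a null function that need
   not be zero everywhere; pairing with [D] removes it. *)
have dUU : L2dot Omega (div U') D = L2dot Omega (div U) D.
  have hE := Xh_lin (-1) hU hU'.
  have := L2dot_div_linl oOmega (XhX hU) (XhX hU') (XhX hE) (Qh_L2 hD).
  rewrite L2dotC (L2dot_null oOmega (Qh_L2 hD) (div_L2 hE)); last first.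
    exact: (divergence_null oOmega (XhX hE) ((ae_eqv_sub0 _ _).1 UU)).
  by rewrite mulN1r addrC => /esym/eqP; rewrite subr_eq0 => /eqP.
have {mP mP'} E : alpha * L2dot Omega P' D = alpha * L2dot Omega P D :=
  etrans (mP' _ hD) (etrans (congr1 (fun x => alpha * L2dot Omega ph D - rho * x) dUU)
    (esym (mP _ hD))).
have {}E := mulfI (lt0r_neq0 halpha) E.
have := L2dot_linr mOmega (-1) (Qh_L2 hP) (Qh_L2 hP') (Qh_L2 hD).
by rewrite (L2dotC _ D P) (L2dotC _ D P') E mulN1r addNr.
Qed.

Lemma step_bound U P : is_step U P ->
  Hnorm Omega alpha U P <=
    Hnorm Omega alpha uh ph + Num.sqrt (rho / nu) * dual_norm Omega F.
Proof.
move=> sUP; have /is_stepP[hU hP _ _] := sUP; have [_ _ eqs] := sUP.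
have gs w : grad_norm Omega w ^+ 2 = grad_dot Omega w w by rewrite sqr_sqrtr// grad_dot_ge0.
have HE w q : Hnorm Omega alpha w q =
    Num.sqrt (grad_dot Omega w w + alpha * L2dot Omega q q).
  by congr (Num.sqrt (_ + alpha * _)); [exact: gs|exact: L2normK].
rewrite (HE U P) (HE uh ph).
have dUL := div_L2 hU; have PL := Qh_L2 hP; have pL := Qh_L2 hph.
apply: sqrt_energy_bound.
- apply: addr_ge0; first exact: grad_dot_ge0.
  by apply: mulr_ge0; [exact: ltW|exact: L2dot_ge0].
- by apply: divr_ge0; exact: ltW.
- exact: dual_norm_ge0.
(* The second test, with the old pressure, is what turns (div U, P - p) into a multiple of |P -
   p|^2. *)
have [e1 e2] := eqs U P hU hP; have [_ e3] := eqs U ph hU hph.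
have subg w : Xh w -> grad_dot Omega (U - uh) w = grad_dot Omega U w - grad_dot Omega uh w.
  by move=> hw; rewrite subr_scaleN1 (grad_dot_linl oOmega (-1) (XhX huh) (XhX hU) (XhX hw)) mulN1r addrC.
rewrite bstar_skew addr0 (subg _ hU) in e1.
rewrite (L2dot_subl PL pL PL) in e2; rewrite (L2dot_subl PL pL pL) in e3.
have gp := grad_dot_ge0 Omega (U - uh).
have hUu : Xh (U - uh) by rewrite subr_scaleN1; exact: Xh_lin.
have gg : grad_dot Omega (U - uh) (U - uh) =
    grad_dot Omega U U - 2 * grad_dot Omega uh U + grad_dot Omega uh uh.
  rewrite (subg _ hUu) (grad_dotC Omega U (U - uh)) (grad_dotC Omega uh (U - uh)).
  rewrite (subg _ hU) (subg _ huh).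
  by rewrite (grad_dotC Omega U uh) sub_sub_double.
have Pp_L2 : L2 Omega (-1 *: ph + P) by exact: L2_lin.
have pp : L2dot Omega (-1 *: ph + P) (-1 *: ph + P) =
    L2dot Omega P P - 2 * L2dot Omega ph P + L2dot Omega ph ph.
  by rewrite L2dot_sqr_lin// sqr_neg_one_comb.
have dpp : L2dot Omega (div U) (-1 *: ph + P) =
    L2dot Omega (div U) P - L2dot Omega (div U) ph.
  by rewrite L2dot_linr// mulN1r addrC.
(* The square whose nonnegativity bounds |P - p| by (rho / alpha) |div U| in [energy_bound], so that
   the grad-div term absorbs it. *)
have h3 := L2dot_ge0 Omega ((rho / alpha) *: div U + (-1 *: ph + P)).
rewrite L2dot_sqr_lin// dpp pp in h3.
have h2 := L2dot_ge0 Omega (-1 *: ph + P); rewrite pp in h2.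
rewrite gg in gp.
rewrite (L2dotC _ ph (div U)) in e1; rewrite (L2dotC _ P ph) in e3.
exact: (energy_bound hnu hrho halpha (sqrtr_ge0 _) (gs U) gp h2 h3 e1 e2 e3
  (le_dual_norm hd oOmega bOmega hF (XhX hU))).
Qed.

End step.

Theorem lemma3p1 (R : realType) (d : nat) (hd : d = 2%N \/ d = 3%N)
  (Omega : set 'rV[R]_d) (hOmega : lipschitz_domain Omega)
  (Xh : set (vector_field R d)) (hXh : fin_dim_subspace (ae_eqv Omega) Xh)
  (hXhX : Xh `<=` Xspace Omega)
  (Qh : set (scalar_field R d)) (hQh : fin_dim_subspace (ae_eqs Omega) Qh)
  (hQhQ : Qh `<=` L20 Omega)
  (f : vector_field R d -> R) (hf : in_dual Omega f)
  (nu rho alpha : R) (hnu : 0 < nu) (hrho : 0 < rho) (halpha : 0 < alpha)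
  (uh : vector_field R d) (ph : scalar_field R d)
  (huh : Xh uh) (hph : Qh ph) :
  exists (Uh : vector_field R d) (Ph : scalar_field R d),
  [/\ is_G Omega Xh Qh f nu rho alpha uh ph Uh Ph,
      forall (Uh' : vector_field R d) (Ph' : scalar_field R d),
        is_G Omega Xh Qh f nu rho alpha uh ph Uh' Ph' ->
        ae_eqv Omega Uh' Uh /\ ae_eqs Omega Ph' Ph &
      Hnorm Omega alpha Uh Ph <=
        Hnorm Omega alpha uh ph + Num.sqrt (rho / nu) * dual_norm Omega f].
Proof.
have [oO _ _ bO _] := hOmega.
have [U [P sUP]] := step_exists hd oO bO hXh hXhX hQh hQhQ hf hnu hrho halpha huh hph.
exists U, P; split=> // [U' P' sUP'|].
  exact: (step_unique hd oO bO hXh hXhX hQh hQhQ hnu hrho halpha huh hph sUP sUP').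
exact: (step_bound hd oO bO hXh hXhX hQh hQhQ hf hnu hrho halpha huh hph sUP).
Qed.
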